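(* For every $\epsilon > 0$ there exist constants $D = D(\epsilon)$ and $K = K(\epsilon)$ such that the following holds. Let $\mathfrak{L}$ be a finite set of $L$ lines in $\mathbb{R}^3$ such that every irreducible algebraic surface of degree at most $D$ contains fewer than $L^{(1/2)+\epsilon}$ lines of $\mathfrak{L}$. Let $r$ be an integer with $2 \le r \le 2 L^{1/2}$. Then $$ |P_r(\mathfrak{L})| \le K L^{(3/2)+\epsilon} r^{-2}. $$
   Context: For a set $\mathfrak{L}$ of lines in $\mathbb{R}^3$, a point $x$ is called $r$-rich if it lies in at least $r$ lines of $\mathfrak{L}$, and $P_r(\mathfrak{L})$ denotes the set of $r$-rich points of $\mathfrak{L}$. An irreducible algebraic surface of degree at most $D$ in $\mathbb{R}^3$ is the real zero set $Z(Q) = \{x \in \mathbb{R}^3 : Q(x) = 0\}$ of an irreducible polynomial $Q \in \mathbb{R}[x_1,x_2,x_3]$ of degree at most $D$. A line is contained in (lies in) a surface if it is a subset of it. *)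

(* Defs.v *)
(* MathComp with MathComp-Analysis and multinomials; the notations of mpoly
   clash with those of MathComp-Analysis, so [{mpoly R[3]}] is [mpoly 3 R]. *)
From mathcomp Require Import all_boot all_order all_algebra finmap.
From mathcomp Require Import boolp classical_sets functions cardinality.
From mathcomp Require Import reals exp.
From mathcomp Require Import -(notations) mpoly.

Set Implicit Arguments.
Unset Strict Implicit.
Unset Printing Implicit Defensive.

Import Order.TTheory GRing.Theory Num.Theory.
Local Open Scope classical_set_scope.
Local Open Scope ring_scope.

Definition irreducible_elt (A : idomainType) (p : A) : Prop :=
  [/\ p != 0, p \isn't a GRing.unit &
      forall q s : A, p = q * s ->
        q \is a GRing.unit \/ s \is a GRing.unit].

Definition zero_set (R : realType) (Q : mpoly 3 R) : set 'rV[R]_3 :=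
  [set x | meval (fun i => x ord0 i) Q = 0].

(* [msize Q] is the total degree plus one for nonzero [Q]. *)
Definition irreducible_surface (R : realType) (D : nat)
    (S : set 'rV[R]_3) : Prop :=
  exists Q : mpoly 3 R,
    [/\ irreducible_elt Q, (msize Q <= D.+1)%N & S = zero_set Q].

Definition is_line (R : realType) (l : set 'rV[R]_3) : Prop :=
  exists p v : 'rV[R]_3, v != 0 /\ l = [set p + t *: v | t in [set: R]].

Definition lines_in (R : realType) (Ls : {fset set 'rV[R]_3})
    (S : set 'rV[R]_3) : {fset set 'rV[R]_3} :=
  [fset l in Ls | `[< (l `<=` S)%classic >]]%fset.

Definition rich_points (R : realType) (Ls : {fset set 'rV[R]_3}) (r : nat) :
    set 'rV[R]_3 :=
  [set x | (r <= #|` [fset l in Ls | x \in l]%fset|)%N].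

(* Main.v *)
Require Import Defs.
From HB Require Import structures.
From mathcomp Require Import all_boot all_order all_algebra finmap.
From mathcomp Require Import boolp classical_sets functions cardinality.
From mathcomp Require Import reals exp.
From mathcomp Require Import perm ring lra zify polyrcf.
From mathcomp Require Import -(notations) mpoly.
Import Order.TTheory GRing.Theory Num.Theory.
Local Open Scope classical_set_scope.
Local Open Scope ring_scope.

Set Implicit Arguments.
Unset Strict Implicit.
Unset Printing Implicit Defensive.

(** The argument is Guth's low degree polynomial partitioning, by induction on
    the number [L] of lines, for a statement without hypothesis on surfaces that
    only counts the [r]-rich points [x] such that no irreducible surface of
    degree at most [D] with at least [L^(1/2+eps)] lines has more than [r/2] of
    its lines through [x].  A product of bisecting polynomials, of bounded degree
    [18 w], cuts the points into [w^3] cells of equal size, while a line outside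
    the zero set meets [O(w)] cells; so in half of the cells, counted with points,
    there are only [O(L/w^2)] lines, and induction gains a factor [w^(-2 eps)].
    The points of a cell lost to the induction hypothesis are rich inside a
    surface that is crowded for the cell but not for [L]; two such surfaces share
    boundedly many lines, hence there are few of them, and counting pairs of lines
    in each suffices.  Points of the zero set either have [r/2] lines transversal
    to one of its components, or are rich inside that component.

    Bisecting polynomials come from a discrete ham sandwich theorem, proved
    without topology: the cross polytope is subdivided by cutting it along the
    hyperplanes given by the points themselves, so that on every simplex of the
    subdivision the signs of all points are compatible, and Fan's parity argument
    applies to the labelling by majorities. *)

(** * Fan's parity lemma and the discrete ham sandwich theorem *)

Section Coboundary.
Variable T : Type.
Implicit Types (f g : seq T -> bool) (s t : seq T).

(** A simplex is the list of its vertices and a cochain a boolean function of such lists; the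
    recursion unfolds to the sum modulo 2 of [f] over the facets, each got by deleting one entry. *)
Fixpoint coboundary f s : bool :=
  if s is x :: t then f t (+) coboundary (fun u => f (x :: u)) t else false.

Lemma coboundaryD f g s :
  coboundary (fun u => f u (+) g u) s = coboundary f s (+) coboundary g s.
Proof.
elim: s f g => [|x s IH] f g //=; rewrite IH.
by rewrite -!addbA; congr (_ (+) _); rewrite addbCA.
Qed.

Lemma coboundary_coboundary f s : coboundary (coboundary f) s = false.
Proof.
elim: s f => [|x s IH] f //=.
by rewrite coboundaryD IH addbF addbb.
Qed.

End Coboundary.

Lemma coboundary_map (T U : Type) (h : T -> U) (f : seq U -> bool) s :
  coboundary (fun u => f (map h u)) s = coboundary f (map h s).
Proof.
elim: s f => [|x s IH] f //=; congr (_ (+) _).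
exact: (IH (fun u => f (h x :: u))).
Qed.

Section CoboundaryEq.
Variable T : eqType.
Implicit Types (f g : seq T -> bool) (s t : seq T).

Lemma coboundary_ext f g s :
  (forall t, size t = (size s).-1 -> {subset t <= s} -> f t = g t) ->
  coboundary f s = coboundary g s.
Proof.
elim: s f g => [|x s IH] f g //= fg; congr (_ (+) _).
  by apply: fg => // y ys; rewrite inE ys orbT.
case: s => [//|y s] in IH fg *; apply: IH => t st ts; apply: fg => /=.
  by rewrite st.
by move=> z; rewrite !inE => /orP[->//|/ts]; rewrite inE => ->; rewrite orbT.
Qed.

Lemma coboundary_true f s : coboundary f s ->
  exists t, [/\ size s = (size t).+1, {subset t <= s} & f t].
Proof.
elim: s f => [//|x s IH] f /=; case fs: (f s).
  by exists s; split=> // y ys; rewrite inE ys orbT.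
rewrite addFb => /IH[t [st ts ft]].
exists (x :: t); split=> //=; first by rewrite st.
by move=> y; rewrite !inE => /orP[->//|/ts ->]; rewrite orbT.
Qed.

Lemma coboundary_sym f s :
  (forall u v, perm_eq u v -> f u = f v) ->
  coboundary f s = \big[addb/false]_(x <- s) f (rem x s).
Proof.
elim: s f => [|x s IH] f fP; first by rewrite big_nil.
rewrite big_cons /= eqxx IH => [|u v uv]; last by apply: fP; rewrite perm_cons.
congr (_ (+) _); rewrite !big_seq; apply: eq_bigr => y ys.
by case: eqP => // ->; apply: fP; rewrite perm_sym perm_to_rem.
Qed.

Lemma coboundary_perm f s t :
  (forall u v, perm_eq u v -> f u = f v) ->
  perm_eq s t -> coboundary f s = coboundary f t.
Proof.
move=> fP st; rewrite !coboundary_sym // (perm_big _ st) /=.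
rewrite !big_seq; apply: eq_bigr => x xt; apply: fP.
rewrite -(perm_cons x) -(permPl (perm_to_rem _)) ?(perm_mem st) //.
by rewrite (permPl st) perm_to_rem.
Qed.

End CoboundaryEq.

(** * Fan's identity for alternating labels *)

Section Alternating.
Implicit Types (b : bool) (s t : seq (nat * bool)).

Fixpoint alt_sorted b s :=
  if s is x :: t then
    [&& x.2 == b, all (fun y => (x.1 < y.1)%N) t & alt_sorted (~~ b) t]
  else true.

Definition alternating b s := has (alt_sorted b) (permutations s).

Definition complement_free s :=
  forall x y, x \in s -> y \in s -> x.1 = y.1 -> x.2 = y.2.

Lemma alternatingP b s :
  reflect (exists2 t, perm_eq t s & alt_sorted b t) (alternating b s).
Proof.
apply: (iffP hasP) => [[t]|[t ts tb]].
  by rewrite mem_permutations => ts tb; exists t.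
by exists t => //; rewrite mem_permutations.
Qed.

Lemma alternating_perm b s t : perm_eq s t -> alternating b s = alternating b t.
Proof.
move=> st; apply/alternatingP/alternatingP => -[u us ub]; exists u => //.
  exact: perm_trans us st.
by apply: perm_trans us _; rewrite perm_sym.
Qed.

Lemma alternating_neg b s :
  alternating b (map (fun x => (x.1, ~~ x.2)) s) = alternating (~~ b) s.
Proof.
pose ng (x : nat * bool) := (x.1, ~~ x.2).
have ngK : involutive ng by case=> x c; rewrite /ng /= negbK.
have altN c t : alt_sorted c (map ng t) = alt_sorted (~~ c) t.
  elim: t c => [//|x t IH] c /=; rewrite IH all_map; congr (_ && _).
  by case: (x.2) c => -[].
apply/alternatingP/alternatingP => -[t ts tb].
  exists (map ng t); last by rewrite altN negbK.
  by rewrite -(mapK ngK s); apply: perm_map.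
by exists (map ng t); [apply: perm_map | rewrite altN].
Qed.

(** An injective key refining the order of the indices: sorting by it singles out the only
    permutation that can witness [alternating]. *)
Let key (x : nat * bool) : nat := (x.1.*2 + x.2)%N.
Let leK := relpre key leq.

Let leK_fst x y : leK x y -> (x.1 <= y.1)%N.
Proof.
rewrite /leK /key /= => h; rewrite -leq_double -ltnS.
case: x y h => [a c] [d e] /= h.
have: (a.*2 + c <= d.*2.+1)%N by apply: leq_trans h _; rewrite -addn1 leq_add2l; case: e.
move=> h'; have: (a.*2 <= d.*2.+1)%N by apply: leq_trans h'; rewrite leq_addr.
rewrite leq_eqVlt => /orP[/eqP ad|//].
by have := odd_double a; rewrite ad /= odd_double.
Qed.

Let leK_lt x y : (x.1 < y.1)%N -> leK x y.
Proof.
case: x y => [a c] [d e] /= h; rewrite /leK /key /=.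
apply: leq_trans (leq_addr _ _).
apply: (@leq_trans (a.+1).*2); last by rewrite leq_double.
by rewrite doubleS; case: c; rewrite ?addn1 ?addn0 // leqW.
Qed.

Let key_inj : injective key.
Proof.
case=> [a c] [d e]; rewrite /key /= => h.
have ce : c = e by have := congr1 odd h; rewrite !oddD !odd_double; case: c e {h} => -[].
by move: h; rewrite ce => /addIn /double_inj ->.
Qed.

Let alt_sorted_leK b t : alt_sorted b t -> sorted leK t.
Proof.
elim: t b => [//|x t IH] b /= /and3P[_ xt /IH].
case: t xt {IH} => [//|y t] /andP[xy _] st.
by apply/andP; split=> //; apply: leK_lt.
Qed.

Let leK_trans : transitive leK.
Proof. by move=> x y z; apply: leq_trans. Qed.

Let alternating_sorted b s : sorted leK s -> alternating b s = alt_sorted b s.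
Proof.
move=> ss; apply/alternatingP/idP => [[t ts tb]|sb]; last by exists s.
rewrite -(_ : t = s) //; apply: (sorted_eq leK_trans _ _ ss ts).
  by move=> x y; rewrite -eqn_leq => /eqP /key_inj.
exact: alt_sorted_leK tb.
Qed.

(** Induction on the first label [x]. If its sign is not [b], only the facet without [x] can count.
    If it is [b], either all other indices are larger and the induction hypothesis applies to the
    tail, or the next label equals [x] and the two facets that delete one of them cancel. *)
Let fan_sorted b s : sorted leK s -> complement_free s ->
  coboundary (alt_sorted b) s = alt_sorted b s (+) alt_sorted (~~ b) s.
Proof.
elim: s b => [//|x t IH] b sx cf.
have xt y : y \in t -> (x.1 <= y.1)%N.
  move: sx; rewrite /= (path_sortedE leK_trans) => /andP[/allP h _] /h.
  exact: leK_fst.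
have st : sorted leK t := path_sorted sx.
have cft : complement_free t.
  by move=> y z yt zt; apply: cf; rewrite inE ?yt ?zt orbT.
rewrite [LHS]/= [alt_sorted _ (x :: t)]/= [alt_sorted (~~ b) (x :: t)]/= negbK.
have [xb|xb] := eqVneq x.2 b; last first.
  rewrite (@coboundary_ext _ _ (fun=> false)) //.
  have -> : coboundary (fun=> false) t = false.
    by elim: (t) => [|y u /= ->].
  have -> : x.2 == ~~ b by move: xb; case: (x.2) b => -[].
  rewrite addbF /=; case tb: (alt_sorted b t); last by rewrite andbF.
  rewrite andbT; apply/esym/allP => y yt.
  case: t tb yt cf xt {IH sx st cft} => [//|z t] /= /and3P[/eqP zb zt _] yt cf xt.
  (* The head [z] of the tail has sign [b], opposite to that of [x], so equal indices would
     contradict complement-freeness. *)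
  have xz : (x.1 < z.1)%N.
    rewrite ltn_neqAle xt ?mem_head // andbT; apply/eqP => xz.
    by move: xb; rewrite (cf _ z) ?mem_head ?zb ?eqxx // inE mem_head orbT.
  by move: yt; rewrite inE => /orP[/eqP -> //|/(allP zt)]; apply: ltn_trans.
have -> : x.2 == ~~ b = false by rewrite xb; case: (b).
rewrite /= addbF.
have [xlt|] := boolP (all _ t).
  rewrite (@coboundary_ext _ _ (alt_sorted (~~ b))); last first.
    move=> u _ ut; rewrite [X in X && _](_ : _ = true) //.
    by apply/allP => y /ut /(allP xlt).
  by rewrite IH // negbK addbCA addbb addbF.
case: t sx cf xt st cft {IH} => [//|y t] sx cf xt st cft.
rewrite [all _ _]/=; case: (ltngtP x.1 y.1) => [xy|xy|xy _].
- case/negP; apply/allP => z zt /=; apply: leq_trans xy _.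
  move: st; rewrite /= (path_sortedE leK_trans) => /andP[/allP h _].
  exact/leK_fst/h.
- by have := xt y (mem_head _ _); rewrite leqNgt xy.
rewrite [coboundary _ _]/= (@coboundary_ext _ (fun u => _ && _) (fun=> false)); last first.
  by move=> u _ _; rewrite xy ltnn.
have -> : coboundary (fun=> false) t = false.
  by elim: (t) => [|z u /= ->].
rewrite /=; have -> : y.2 == b by rewrite -xb (cf x y) ?mem_head // inE mem_head orbT.
by rewrite xy addbF andTb addbb.
Qed.

(* Fan's identity: a simplex has an odd number of positive alternating facets
   exactly when it is itself alternating, with either leading sign. *)
Lemma coboundary_alternating b s : complement_free s ->
  coboundary (alternating b) s = alternating b s (+) alternating (~~ b) s.
Proof.
move=> cf; pose t := sort leK s.
have ts : perm_eq t s by rewrite perm_sort.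
have st : sorted leK t by apply: sort_sorted => x y; apply: leq_total.
rewrite -(coboundary_perm (@alternating_perm b) ts).
rewrite -!(alternating_perm _ ts) !alternating_sorted // -fan_sorted //; last first.
  by move=> x y; rewrite !(perm_mem ts); apply: cf.
(* Facets of a sorted list are sorted, so [alternating] may be replaced by [alt_sorted] on each; [u]
   holds the vertices already kept. *)
have subs u v : sorted leK (u ++ v) -> coboundary (fun w => alternating b (u ++ w)) v
    = coboundary (fun w => alt_sorted b (u ++ w)) v.
  elim: v u => [//|x v IH] u suv /=; congr (_ (+) _).
    rewrite alternating_sorted //; apply: (subseq_sorted leK_trans) suv.
    by rewrite cat_subseq // subseq_cons.
  have := IH (rcons u x); rewrite cat_rcons => /(_ suv).
  rewrite (@coboundary_ext _ (fun w => alternating b (rcons u x ++ w))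
    (fun w => alternating b (u ++ x :: w))) => [->|w _ _]; last by rewrite cat_rcons.
  by apply: coboundary_ext => w _ _; rewrite cat_rcons.
exact: (subs [::]).
Qed.

Lemma alternating_size b s n : alternating b s ->
  (forall x, x \in s -> x.1 < n)%N -> (size s <= n)%N.
Proof.
case/alternatingP => t ts tb sn; rewrite -(perm_size ts).
have ut : uniq (map fst t).
  elim: t b {ts} tb => [//|x t IH] b /= /and3P[_ xt /IH ->]; rewrite andbT.
  by apply/mapP => -[y /(allP xt) xy xy1]; move: xy; rewrite -xy1 ltnn.
rewrite -(size_map fst) -(size_iota 0 n); apply: uniq_leq_size => // k.
by case/mapP => x xt ->; rewrite mem_iota sn // -(perm_mem ts).
Qed.

End Alternating.

(** * The boundary sphere of the cross polytope *)

Section CrossPolytope.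
Variable V : zmodType.
Implicit Types (f : seq V -> bool) (es : seq V).

(** Evaluation of [f] on the sphere bounding the cross polytope: a maximal simplex chooses a sign
    for each entry of [es]. *)
Fixpoint cross_sum f es : bool :=
  if es is e :: es' then
    cross_sum (fun s => f (e :: s)) es' (+) cross_sum (fun s => f (- e :: s)) es'
  else f [::].

Lemma cross_sumD f g es :
  cross_sum (fun s => f s (+) g s) es = cross_sum f es (+) cross_sum g es.
Proof.
by elim: es f g => [//|e es IH] f g /=; rewrite !IH addbACA.
Qed.

Definition signed es s := all2 (fun v e => (v == e) || (v == - e)) s es.

Lemma eq_cross_sum f g es : (forall s, signed es s -> f s = g s) ->
  cross_sum f es = cross_sum g es.
Proof.
elim: es f g => [|e es IH] f g fg /=; first exact: fg.
by congr (_ (+) _); apply: IH => s ss; apply: fg; rewrite /signed /= eqxx ?orbT.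
Qed.

Lemma cross_sum_opp f es : cross_sum (fun s => f (map -%R s)) es = cross_sum f es.
Proof.
elim: es f => [//|e es IH] f /=.
by rewrite (IH (fun s => f (- e :: s))) (IH (fun s => f (- - e :: s))) opprK addbC.
Qed.

(* A hemisphere of the cross polytope is bounded by its equator. *)
Lemma cross_sum_coboundary e f es :
  cross_sum (fun s => coboundary f (e :: s)) es = cross_sum f es.
Proof.
(* The sphere is a cycle: its two hemispheres have the same boundary. *)
have cyc es' : forall g, cross_sum (coboundary g) es' = false.
  elim: es' => [//|e' es' IH] g.
  have half c : cross_sum (fun s => coboundary g (c :: s)) es' = cross_sum g es'.
    by rewrite /= cross_sumD IH addbF.
  by rewrite /= -/(cross_sum _ _) [X in X (+) _]half [X in _ (+) X]half addbb.
by rewrite /= cross_sumD cyc addbF.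
Qed.


Lemma cross_sum_true f es : cross_sum f es -> exists2 s, signed es s & f s.
Proof.
elim: es f => [|e es IH] f /=; first by exists [::].
case fe: (cross_sum (fun s => f (e :: s)) es).
  by case: (IH _ fe) => s ss fs; exists (e :: s); rewrite // /signed /= eqxx.
rewrite addFb => /IH[s ss fs].
by exists (- e :: s); rewrite // /signed /= eqxx orbT.
Qed.

End CrossPolytope.

(** * Subdivision of simplices along hyperplanes *)

Section Cutting.
Variables (F : realDomainType) (V : lmodType F) (X : eqType) (ev : X -> V -> F).
Hypothesis ev_lin : forall x a b v w, ev x (a *: v + b *: w) = a * ev x v + b * ev x w.
Implicit Types (f g : seq V -> bool) (s t : seq V) (x : X).

Let evN x v : ev x (- v) = - ev x v.
Proof. by have := ev_lin x (-1) 0 v 0; rewrite scaleN1r scale0r addr0 mulN1r mul0r addr0. Qed.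

Definition two_sided x s := has (fun v => 0 < ev x v) s && has (fun v => ev x v < 0) s.

(** On a two-sided simplex, the positive combination of the first positive and the first negative
    vertex that lies on the hyperplane of [x]. Choosing by position makes it commute with the
    antipodal map. *)
Definition cut_point x s :=
  let v := nth 0 s (find (fun v => 0 < ev x v) s) in
  let w := nth 0 s (find (fun v => ev x v < 0) s) in
  ev x v *: w - ev x w *: v.

(* The pullback of a cochain under the subdivision that cuts every simplex
   meeting both sides of a hyperplane: such a simplex is replaced by the cone,
   from a point of the hyperplane, over its subdivided boundary.  The first
   argument is fuel, meant to be the number of vertices. *)
Fixpoint cut_rec n x f s : bool :=
  if n is n'.+1 then
    if two_sided x s then
      coboundary (cut_rec n' x (fun t => f (cut_point x s :: t))) s
    else f s
  else f s.

Definition cut x f s := cut_rec (size s) x f s.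

Definition conic (C : V -> Prop) := forall v w a b,
  C v -> C w -> 0 < a -> 0 < b -> C (a *: v + b *: w).

Lemma two_sided_opp x s : two_sided x (map -%R s) = two_sided x s.
Proof.
rewrite /two_sided !has_map andbC; congr (_ && _); apply: eq_has => v /=.
  by rewrite evN oppr_lt0.
by rewrite evN oppr_gt0.
Qed.

Lemma two_sided_sub x s t : {subset t <= s} -> two_sided x t -> two_sided x s.
Proof.
move=> ts /andP[/hasP[v vt v0] /hasP[w wt w0]].
by apply/andP; split; apply/hasP; [exists v => //; apply: ts | exists w => //; apply: ts].
Qed.

Lemma cut_point_opp x s : two_sided x s -> cut_point x (map -%R s) = - cut_point x s.
Proof.
move=> /andP[hp hn]; rewrite /cut_point /= !find_map.
rewrite (@eq_find _ (preim _ (fun v => 0 < ev x v)) (fun v => ev x v < 0)); last first.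
  by move=> v /=; rewrite evN oppr_gt0.
rewrite (@eq_find _ (preim _ (fun v => ev x v < 0)) (fun v => 0 < ev x v)); last first.
  by move=> v /=; rewrite evN oppr_lt0.
rewrite !(nth_map 0) -?has_find // !evN !scaleNr !scalerN !opprK opprB.
by rewrite addrC.
Qed.

Lemma ev_cut_point x s : ev x (cut_point x s) = 0.
Proof.
rewrite /cut_point -scaleNr ev_lin mulNr; apply/eqP; rewrite subr_eq0.
by rewrite mulrC.
Qed.

Lemma conic_cut_point x s C : conic C -> two_sided x s ->
  (forall v, v \in s -> C v) -> C (cut_point x s).
Proof.
move=> cC /andP[hp hn] sC; rewrite /cut_point -scaleNr.
apply: cC; rewrite ?oppr_gt0.
- by apply/sC/mem_nth; rewrite -has_find.
- by apply/sC/mem_nth; rewrite -has_find.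
- exact: (nth_find 0 hp).
- exact: (nth_find 0 hn).
Qed.

Lemma cut_recD n x f g s :
  cut_rec n x (fun t => f t (+) g t) s = cut_rec n x f s (+) cut_rec n x g s.
Proof.
elim: n f g s => [//|n IH] f g s /=; case: ifP => // _.
by rewrite -coboundaryD; apply: coboundary_ext => t _ _; rewrite IH.
Qed.

Lemma cut_rec_one_sided n x f s : ~~ two_sided x s -> cut_rec n x f s = f s.
Proof. by case: n => //= n /negbTE ->. Qed.

(** Subdivision is a chain map. On a two-sided simplex the cone yields the subdivided boundary plus
    a coboundary of a coboundary, which vanishes; a one-sided simplex has only one-sided facets. *)
Lemma cut_rec_coboundary n x f s : size s = n.+1 ->
  cut_rec n.+1 x (coboundary f) s = coboundary (cut_rec n x f) s.
Proof.
elim: n f s => [|n IH] f s ss.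
  case: s ss => [//|v [|//]] _; rewrite cut_rec_one_sided //.
  by apply/negP => /andP[] /=; rewrite !orbF => /lt_trans h /h; rewrite ltxx.
have [ts|ts] := boolP (two_sided x s); last first.
  rewrite cut_rec_one_sided //; apply: coboundary_ext => t _ tsub.
  by rewrite cut_rec_one_sided //; apply: contra ts; apply: two_sided_sub.
rewrite [LHS]/= ts -/(cut_rec n.+1 x).
rewrite (@coboundary_ext _ _ (fun t => cut_rec n.+1 x f t (+)
   coboundary (cut_rec n x (fun u => f (cut_point x s :: u))) t)); last first.
  move=> t st _; rewrite -[coboundary (cut_rec n x (fun u => f (_ x s :: u))) t]IH;
    last by rewrite st ss.
  exact: (cut_recD n.+1 x f (coboundary (fun u => f (cut_point x s :: u))) t).
by rewrite coboundaryD coboundary_coboundary addbF.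
Qed.

Lemma cut_coboundary x f s : cut x (coboundary f) s = coboundary (cut x f) s.
Proof.
case: s => [//|v s]; rewrite /cut cut_rec_coboundary //.
by apply: coboundary_ext => t ->.
Qed.

Lemma cut_opp x f s : cut x (fun t => f (map -%R t)) s = cut x f (map -%R s).
Proof.
rewrite /cut size_map; move: (size s) => n; elim: n f s => [//|n IH] f s /=.
rewrite two_sided_opp; case: ifP => // ts.
rewrite -coboundary_map; apply: coboundary_ext => t _ _ /=.
by rewrite cut_point_opp // -IH.
Qed.

Lemma cut_true x f s : cut x f s ->
  exists t, [/\ size t = size s, f t, ~~ two_sided x t &
    forall C, conic C -> (forall v, v \in s -> C v) -> forall v, v \in t -> C v].
Proof.
rewrite /cut; move: {-2}(size s) (erefl (size s)) => n.
elim: n f s => [|n IH] f s ss; first by case: s ss => //= _ f0; exists [::].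
have [ts|ts] := boolP (two_sided x s); last first.
  by rewrite cut_rec_one_sided // => fs; exists s.
rewrite /= ts => /coboundary_true[t0 [st0 sub0]].
have sn : n = size t0 by apply/eqP; rewrite -eqSS -st0 ss.
case/(IH _ _ sn) => t [st ft tx tC].
exists (cut_point x s :: t); split=> //=.
- by rewrite st.
(* The apex lies on the hyperplane, hence on neither strict side. *)
- by apply: contra tx; rewrite /two_sided /= ev_cut_point ltxx.
move=> C cC sC v; rewrite inE => /orP[/eqP ->|vt].
  exact: conic_cut_point.
by apply: (tC C) vt => // w /sub0; apply: sC.
Qed.

Fixpoint cuts xs f s : bool :=
  if xs is x :: xs' then cut x (cuts xs' f) s else f s.

Lemma cut_ext x f g s : (forall t, f t = g t) -> cut x f s = cut x g s.
Proof.
move=> fg; rewrite /cut; move: (size s) => n; elim: n f g s fg => [|n IH] f g s fg /=; first exact: fg.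
case: ifP => // _; apply: coboundary_ext => t _ _; exact: IH.
Qed.

Lemma cutsD xs f g s : cuts xs (fun t => f t (+) g t) s = cuts xs f s (+) cuts xs g s.
Proof.
elim: xs f g s => [//|x xs IH] f g s /=.
by rewrite (cut_ext _ _ (IH f g)) /cut cut_recD.
Qed.

Lemma cuts_coboundary xs f s : cuts xs (coboundary f) s = coboundary (cuts xs f) s.
Proof.
elim: xs f s => [//|x xs IH] f s /=.
by rewrite (cut_ext _ _ (IH f)) cut_coboundary.
Qed.

Lemma cuts_opp xs f s : cuts xs (fun t => f (map -%R t)) s = cuts xs f (map -%R s).
Proof.
elim: xs f s => [//|x xs IH] f s /=.
by rewrite (cut_ext _ _ (IH f)) cut_opp.
Qed.

(** Closed half spaces are conic, so later cuts keep a simplex on the side it already occupies;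
    after all cuts it is one-sided for every point at once. *)
Lemma cuts_true xs f s : cuts xs f s ->
  exists t, [/\ size t = size s, f t, {in xs, forall x, ~~ two_sided x t} &
    forall C, conic C -> (forall v, v \in s -> C v) -> forall v, v \in t -> C v].
Proof.
elim: xs f s => [|x xs IH] f s /=; first by exists s.
case/cut_true => t [st + tx tC] => /IH[u [su fu ux uC]].
exists u; split=> //; first by rewrite su.
  move=> y; rewrite inE => /orP[/eqP ->|/ux //].
  move: tx; rewrite /two_sided negb_and -!all_predC => /orP[] /allP tx.
    apply/negP => /andP[/hasP[v vu v0] _].
    have : ev x v <= 0.
      apply: (uC (fun v => ev x v <= 0)) vu => [w w' a b w0 w'0 a0 b0|w /tx] /=.
        by rewrite ev_lin -[leRHS]addr0 lerD // pmulr_rle0.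
      by rewrite -leNgt.
    by rewrite leNgt v0.
  apply/negP => /andP[_ /hasP[v vu v0]].
  have : 0 <= ev x v.
    apply: (uC (fun v => 0 <= ev x v)) vu => [w w' a b w0 w'0 a0 b0|w /tx] /=.
      by rewrite ev_lin addr_ge0 // pmulr_rge0.
    by rewrite -leNgt.
  by rewrite leNgt v0.
by move=> C cC sC v; apply: uC => // w; apply: tC.
Qed.

(** If the pullbacks differed, that of the sum of [f] and [g] would be nonzero, and [cuts_true]
    would give a simplex of the subdivision where they differ. *)
Lemma eq_cuts xs f g s :
  (forall t, {in xs, forall x, ~~ two_sided x t} ->
     (forall C, conic C -> (forall v, v \in s -> C v) -> forall v, v \in t -> C v) ->
     f t = g t) ->
  cuts xs f s = cuts xs g s.
Proof.
move=> fg; apply/eqP; rewrite -[_ == _]negbK; apply/negP => ne.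
have: cuts xs (fun t => f t (+) g t) s by rewrite cutsD; move: ne; case: (cuts xs f s) (cuts xs g s) => -[].
by case/cuts_true => t [_ + tx tC]; rewrite fg // addbb.
Qed.

Lemma cuts_nil xs f : cuts xs f [::] = f [::].
Proof. by elim: xs. Qed.

End Cutting.

(** Otherwise label each nonzero vector by the first list that it fails to bisect and by the side of
    the majority. The labelling is antipodal, and complement-free on the subdivided cross polytope,
    so Fan's identity yields an alternating simplex with [m] vertices, although there are only
    [size A] indices. *)
Lemma ham_sandwich (F : realDomainType) (m : nat) (X : eqType)
    (ev : X -> 'rV[F]_m -> F) (A : seq (seq X)) :
  (forall x a b v w, ev x (a *: v + b *: w) = a * ev x v + b * ev x w) ->
  (size A < m)%N ->
  exists2 u, u != 0 & forall S, S \in A ->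
    ((count (fun x => 0 < ev x u)%R S).*2 <= size S)%N /\
    ((count (fun x => ev x u < 0)%R S).*2 <= size S)%N.
Proof.
move=> ev_lin Am.
have evN x v : ev x (- v) = - ev x v.
  by have := ev_lin x (-1) 0 v 0; rewrite scaleN1r scale0r addr0 mulN1r mul0r addr0.
pose sev b v x : F := if b then ev x v else - ev x v.
pose maj b v S := (size S < (count (fun x => 0 < sev b v x)%R S).*2)%N.
have majN b v S : maj b (- v) S = maj (~~ b) v S.
  rewrite /maj; congr (_ < _.*2)%N; apply: eq_count => x.
  by rewrite /sev evN; case: b; rewrite ?opprK.
(* Two strict majorities of the same list overlap. *)
have maj_pair v w S : maj true v S -> maj false w S ->
    exists2 x, x \in S & (0 < ev x v) && (ev x w < 0).
  rewrite /maj => hv hw; apply/hasP; rewrite has_count.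
  have := count_predUI (fun x => 0 < sev true v x) (fun x => 0 < sev false w x) S.
  rewrite (@eq_count _ (predI _ _) (fun x => (0 < ev x v) && (ev x w < 0))); last first.
    by move=> x /=; rewrite oppr_gt0.
  case: posnP => // ->; rewrite addn0 => h; exfalso.
  have : ((size S).*2 < (size S).*2)%N.
    move: (leq_add hv hw); rewrite addSn addnS -doubleD -h addnn => /ltnW /leq_trans; apply.
    by rewrite leq_double count_size.
  by rewrite ltnn.
have maj_disj v S : maj true v S -> maj false v S -> False.
  by move=> /maj_pair h /h[x _ /andP[/lt_trans h1 /h1]]; rewrite ltxx.
pose cut_by v S := maj true v S || maj false v S.
have [[u [u0 hu]]|nou] := boolp.pselect (exists u, u != 0 /\ ~~ has (cut_by u) A).
  exists u => // S SA; move: (hasPn hu S SA); rewrite negb_or /maj -!leqNgt.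
  case/andP=> -> h; split=> //; move: h.
  by rewrite (@eq_count _ _ (fun x => ev x u < 0)) => [|x] //; rewrite /sev oppr_gt0.
exfalso.
have cutA v : v != 0 -> has (cut_by v) A.
  by move=> v0; apply/negP => /negP nv; apply: nou; exists v.
pose lab v := let i := find (cut_by v) A in (i, maj true v (nth [::] A i)).
have labN v : v != 0 -> lab (- v) = ((lab v).1, ~~ (lab v).2).
  move=> v0; have E : find (cut_by (- v)) A = find (cut_by v) A.
    by apply: eq_find => S; rewrite /cut_by !majN orbC.
  rewrite /lab E /= majN /=; congr pair.
  have := nth_find [::] (cutA _ v0); rewrite /cut_by.
  have := @maj_disj v (nth [::] A (find (cut_by v) A)).
  by case: (maj true v) => [] /=; case: (maj false v) => // /(_ isT isT).
pose xs := flatten A.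
pose f b s := alternating b (map lab s).
have lab_cf t : {in xs, forall x, ~~ two_sided ev x t} -> (forall v, v \in t -> v != 0) ->
    complement_free (map lab t).
  move=> tx t0 p q /mapP[v vt ->] /mapP[w wt ->] vw.
  have key v' w' : v' \in t -> w' \in t -> (lab v').1 = (lab w').1 ->
      (lab v').2 -> (lab w').2.
    move=> v't w't /= E; rewrite E => mv; apply/negPn/negP => mw.
    have := nth_find [::] (cutA _ (t0 _ w't)); rewrite {1}/cut_by (negbTE mw) /=.
    move=> /(maj_pair _ _ _ mv)[x xA /andP[xv xw]].
    have: x \in xs.
      by apply/flattenP; exists (nth [::] A (find (cut_by w') A)); rewrite // mem_nth // -has_find cutA ?t0.
    move/tx/negP; apply; apply/andP; split; apply/hasP.
      by exists v'.
    by exists w'.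
  by apply/idP/idP; apply: key.
pose G := cuts ev xs (f true).
have pos (C : 'rV[F]_m -> Prop) (t : seq 'rV[F]_m) : ~ C 0 -> (forall v, v \in t -> C v) ->
   forall v, v \in t -> v != 0.
  by move=> C0 tC v /tC Cv; apply/eqP => v0; apply: C0; rewrite -v0.
(* Fan's identity pulled back to the subdivision; antipodality turns leading sign [false] on [s]
   into leading sign [true] on the opposite simplex. A cone avoiding [0] keeps all vertices nonzero,
   hence labelled. *)
have half s : (exists2 C, conic C & ~ C 0 /\ forall v, v \in s -> C v) ->
    coboundary G s = G s (+) G (map -%R s).
  case=> C cC [C0 sC]; rewrite /G -cuts_coboundary // -cuts_opp // -cutsD //.
  apply: eq_cuts => // t tx tC.
  have t0 := pos C t C0 (tC _ cC sC).
  rewrite /f coboundary_map coboundary_alternating; last exact: lab_cf.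
  congr (_ (+) _); rewrite -alternating_neg -!map_comp; congr (alternating _ _).
  by apply/eq_in_map => v vt /=; rewrite labN ?t0 //= negbK.
(* Pairing antipodal simplices and applying [half] reduces the sphere on [e :: es] to the boundary
   of a hemisphere, which is the sphere on [es]; the empty simplex counts once. *)
have all_cones es : (forall s, signed es s ->
    exists2 C : 'rV[F]_m -> Prop, conic C & ~ C 0 /\ forall v, v \in s -> C v) ->
    cross_sum G es.
  elim: es => [|e es IH] pes; first by rewrite /= /G cuts_nil.
  have -> : cross_sum G (e :: es) = cross_sum G es.
    rewrite -[RHS](cross_sum_coboundary e) [LHS]/=.
    rewrite -[X in _ (+) X]cross_sum_opp -cross_sumD; apply: eq_cross_sum => s ss.
    rewrite [RHS]half //; apply: pes.
    by move: ss; rewrite /signed /= eqxx.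
  apply: IH => s ss; case: (pes (e :: s)) => [|C cC [C0 sC]].
    by move: ss; rewrite /signed /= eqxx.
  by exists C => //; split=> // v vs; apply: sC; rewrite inE vs orbT.
pose es : seq 'rV[F]_m := [seq delta_mx 0 i | i <- enum 'I_m].
have szes : size es = m by rewrite size_map size_enum_ord.
have es_cone s : signed es s ->
    exists2 C : 'rV[F]_m -> Prop, conic C & ~ C 0 /\ forall v, v \in s -> C v.
  rewrite /signed all2E => /andP[/eqP ss sP].
  rewrite szes in ss.
  have sE (j : 'I_m) : (nth 0 s j == delta_mx 0 j) || (nth 0 s j == - delta_mx 0 j).
    have jz : j \in enum 'I_m by rewrite mem_enum.
    have := allP sP (nth 0 s j, nth 0 es j); rewrite -nth_zip ?szes ?ss //.
    rewrite mem_nth ?size_zip ?szes ?ss ?minnn // nth_zip ?szes ?ss //= => /(_ isT).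
    by rewrite (nth_map j) ?size_enum_ord // nth_ord_enum.
  (* The open half space of vectors that pair positively with the sum of the entries of [s]. *)
  exists (fun v : 'rV[F]_m => 0 < \sum_(i < m) (nth 0 s i) ord0 i * v ord0 i).
    move=> v w a b v0 w0 a0 b0.
    have -> : \sum_(i < m) (nth 0 s i) ord0 i * (a *: v + b *: w) ord0 i
       = a * (\sum_(i < m) (nth 0 s i) ord0 i * v ord0 i) + b * \sum_(i < m) (nth 0 s i) ord0 i * w ord0 i.
      rewrite !mulr_sumr -big_split; apply: eq_bigr => i _ /=.
      by rewrite !mxE mulrDr !(mulrCA (nth 0 s i ord0 i)).
    by rewrite addr_gt0 // mulr_gt0.
  split=> [|v vs].
    by rewrite big1 ?ltxx // => i _; rewrite mxE mulr0.
  have /(nthP 0)[j] := vs; rewrite ss => jm <-.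
  pose j' := Ordinal jm; rewrite -[j]/(nat_of_ord j').
  rewrite (bigD1 j') //= big1 ?addr0.
    by case/orP: (sE j') => /eqP ->; rewrite !mxE !eqxx /= ?mulrNN mulr1 ltr01.
  move=> i ij; case/orP: (sE j') => /eqP ->; rewrite !mxE (negbTE ij) andbF ?oppr0 mulr0 //.
case/cross_sum_true: (all_cones es es_cone) => s ss /cuts_true -/(_ ev_lin)[t [st ft _ tC]].
case: (es_cone _ ss) => C cC [C0 sC].
have t0 := pos C t C0 (tC _ cC sC).
have := alternating_size (n := size A) ft.
rewrite size_map st => /(_ _); rewrite leqNgt.
have -> : size s = m by move: ss; rewrite /signed all2E szes => /andP[/eqP].
rewrite Am; suff: forall x, x \in map lab t -> (x.1 < size A)%N by move=> h /(_ h).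
by move=> x /mapP[v /t0 v0 ->] /=; rewrite -has_find cutA.
Qed.

(** * Unique factorization and common lines of two surfaces *)

Definition rdvd (A : comRingType) (a b : A) := exists c, b = c * a.

Definition prime_elt (A : idomainType) (p : A) : Prop :=
  [/\ p != 0, p \isn't a GRing.unit &
      forall a b, rdvd p (a * b) -> rdvd p a \/ rdvd p b].

(** A size that makes factorizations terminate. *)
Definition degree_like (A : idomainType) (d : A -> nat) : Prop :=
  (forall a b, a != 0 -> b != 0 -> d (a * b)%R = (d a + d b)%N) /\
  (forall a, a != 0 -> d a = 0%N -> a \is a GRing.unit).

(** Unique factorization, in a form that passes to polynomial rings: factorizations terminate and
    irreducible elements are prime. *)
Definition factorial (A : idomainType) : Prop :=
  (exists d : A -> nat, degree_like d) /\
  forall p : A, irreducible_elt p -> prime_elt p.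

Section Divisibility.
Variable A : idomainType.
Implicit Types a b c p : A.

Lemma rdvd_mull a b c : rdvd a b -> rdvd a (c * b).
Proof. by case=> d ->; exists (c * d); rewrite mulrA. Qed.

Lemma rdvd_mulr a b c : rdvd a b -> rdvd a (b * c).
Proof. by rewrite mulrC; apply: rdvd_mull. Qed.

Lemma rdvdD a b c : rdvd a b -> rdvd a c -> rdvd a (b + c).
Proof. by case=> d -> [e ->]; exists (d + e); rewrite mulrDl. Qed.

Lemma rdvdB a b c : rdvd a b -> rdvd a c -> rdvd a (b - c).
Proof. by case=> d -> [e ->]; exists (d - e); rewrite mulrBl. Qed.

Lemma rdvd0 a : rdvd a 0.
Proof. by exists 0; rewrite mul0r. Qed.

Lemma rdvd_irreducible a b : irreducible_elt a -> irreducible_elt b ->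
  rdvd a b -> rdvd b a.
Proof.
move=> [a0 aU _] [_ _ bI] [c E]; case: (bI _ _ E) => [cU|]; last by rewrite (negbTE aU).
by exists c^-1; rewrite E mulKr.
Qed.

Variable d : A -> nat.
Hypothesis dA : degree_like d.

Lemma degree_like_unit a : a \is a GRing.unit -> d a = 0%N.
Proof.
move=> aU; have a0 : a != 0 by apply: contraTneq aU => ->; rewrite unitr0.
have d1 : d 1 = 0%N.
  by have := dA.1 1 1 (oner_neq0 _) (oner_neq0 _); rewrite mulr1; lia.
have := dA.1 a a^-1 a0; rewrite invr_eq0 divrr // d1 => /(_ a0); lia.
Qed.

Lemma irreducible_divisor a : a != 0 -> a \isn't a GRing.unit ->
  exists2 p, irreducible_elt p & rdvd p a.
Proof.
have [n] := ubnP (d a); elim: n a => // n IH a an a0 aU.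
have [ai|ani] := pselect (irreducible_elt a); first by exists a => //; exists 1; rewrite mul1r.
have [q [s [E qU sU]]] : exists q s, [/\ a = q * s, q \isn't a GRing.unit & s \isn't a GRing.unit].
  apply: contrapT => h; apply: ani; split=> // q s E.
  case qU: (q \is a GRing.unit); first by left.
  case sU: (s \is a GRing.unit); first by right.
  by case: h; exists q, s; rewrite qU sU.
have [q0 s0] : q != 0 /\ s != 0.
  by apply/andP; rewrite -negb_or -mulf_eq0 -E.
have ds : d s <> 0%N by move=> /(dA.2 _ s0); rewrite (negbTE sU).
case: (IH q) => //.
  by move: an; rewrite E dA.1 //; lia.
by move=> p pI pq; exists p => //; rewrite E; apply: rdvd_mulr.
Qed.

Lemma irreducible_factorization a : a != 0 ->
  exists u s, [/\ u \is a GRing.unit, forall p, p \in s -> irreducible_elt p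
                & a = u * \prod_(p <- s) p].
Proof.
have [n] := ubnP (d a); elim: n a => // n IH a an a0.
case aU: (a \is a GRing.unit).
  by exists a, [::]; rewrite big_nil mulr1.
have [p pI [b E]] := irreducible_divisor a0 (negbT aU).
have [p0 pU _] := pI.
have b0 : b != 0 by apply: contra_neq a0; rewrite E => ->; rewrite mul0r.
have dp : d p <> 0%N by move=> /(dA.2 _ p0); rewrite (negbTE pU).
case: (IH b) => // [|u [s [uU sI Eb]]].
  by move: an; rewrite E dA.1 //; lia.
exists u, (p :: s); split=> // [q|]; first by rewrite inE => /orP[/eqP -> //|/sI].
by rewrite big_cons E {1}Eb mulrCA mulrC mulrA.
Qed.

End Divisibility.

(** * Gauss's lemma for polynomials over a factorial ring *)

Section PolyFactorial.
Variable A : idomainType.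
Hypothesis Afact : factorial A.
Implicit Types (p f g h : {poly A}) (c q : A).

Lemma rdvd_polyC q f : rdvd q%:P f <-> forall i, rdvd q f`_i.
Proof.
split=> [[g ->] i|qf]; first by exists g`_i; rewrite coefMC.
have [h hE] := choice qf.
exists (\poly_(i < size f) h i); apply/polyP => i; rewrite coefMC coef_poly.
by case: ltnP => [_|fi]; rewrite -?hE // nth_default // mul0r.
Qed.

(** Let [i] and [j] be the first degrees where [q] divides no coefficient of [f], respectively [g]:
    in the coefficient of degree [i + j] of the product, [q] divides every term but one. *)
Lemma prime_polyC q f g : prime_elt q -> rdvd q%:P (f * g) ->
  rdvd q%:P f \/ rdvd q%:P g.
Proof.
move=> [q0 qU qP] qfg.
have least h : ~ rdvd q%:P h -> exists2 i, ~ rdvd q h`_i & forall j, (j < i)%N -> rdvd q h`_j.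
  move=> nh; have ex : exists i, ~~ `[< rdvd q h`_i >].
    apply: contrapT => no; apply: nh; apply/rdvd_polyC => i; apply: contrapT => ni.
    by apply: no; exists i; apply/asboolP.
  case: (ex_minnP ex) => i /asboolP ni imin; exists i => // j ji.
  apply: contrapT => nj; have : ~~ `[< rdvd q h`_j >] by apply/asboolP.
  by move/imin; rewrite leqNgt ji.
apply: contrapT => /not_orP[/least[i ni imin] /least[j nj jmin]].
suff : rdvd q (f`_i * g`_j) by case/qP.
have ii : (i < (i + j).+1)%N by rewrite ltnS leq_addr.
move/rdvd_polyC: qfg => /(_ (i + j)%N).
rewrite coefM (bigD1 (Ordinal ii)) //= addKn => h.
rewrite -[X in rdvd q X](addrK (\sum_(k < (i + j).+1 | k != Ordinal ii) f`_k * g`_(i + j - k))).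
apply: rdvdB => //; elim/big_rec: _ => [|k x /eqP ki qx]; first exact: rdvd0.
apply: rdvdD => //; case: (ltngtP k i) => [ki'|ik|E].
- exact/rdvd_mulr/imin.
- by apply/rdvd_mull/jmin; have := ltn_ord k; lia.
- by case: ki; apply: val_inj.
Qed.

Let cancelC q f g : q != 0 -> f * q%:P = g * q%:P -> f = g.
Proof. by move=> q0 /mulIf; apply; rewrite polyC_eq0. Qed.

Let const_step c : c != 0 -> c \is a GRing.unit \/
  exists q c', [/\ prime_elt q, c = c' * q, c' != 0 & forall d, degree_like d -> (d c' < d c)%N].
Proof.
move=> c0; have [[d dA] irrP] := Afact.
case cU: (c \is a GRing.unit); [by left | right].
have [q qI [c' E]] := irreducible_divisor dA c0 (negbT cU).
have c'0 : c' != 0 by apply: contra_neq c0; rewrite E => ->; rewrite mul0r.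
have [q0 qU _] := qI.
exists q, c'; split=> //; first exact: irrP.
move=> e eA; rewrite E eA.1 //.
have : e q <> 0%N by move=> /(eA.2 _ q0); rewrite (negbTE qU).
lia.
Qed.

(** Clears [c] one prime at a time: a prime factor of [c] divides [h * f] but not [f], so it divides
    [h] and cancels. *)
Let strip_divisor c f g h : c != 0 -> (forall q, prime_elt q -> ~ rdvd q%:P f) ->
  c%:P * g = h * f -> rdvd f g.
Proof.
have [[d dA] _] := Afact.
have [n] := ubnP (d c); elim: n c h => // n IH c h cn c0 fprim E.
case: (const_step c0) => [cU|[q [c' [qP Ec c'0 dc]]]].
  by exists (c^-1%:P * h); rewrite -mulrA -E mulrA -polyCM mulVr // mul1r.
have : rdvd q%:P (h * f) by rewrite -E Ec polyCM mulrAC; apply: rdvd_mull; exists 1; rewrite mul1r.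
case/(prime_polyC qP) => [[h' Eh]|/(fprim _ qP) //].
apply: (IH c' h') => //; first by have := dc d dA; lia.
have [q0 _ _] := qP.
by apply: (cancelC q0); rewrite mulrAC -polyCM -Ec E Eh mulrAC.
Qed.

(** Descends a factorization from the fraction field: each prime factor of [c] divides [g] or [h]
    and is cancelled there without changing degrees. *)
Let strip_product c f g h : c != 0 -> f != 0 -> c%:P * f = g * h ->
  exists g' h', [/\ f = g' * h', size g' = size g & size h' = size h].
Proof.
have [[d dA] _] := Afact.
have [n] := ubnP (d c); elim: n c g h => // n IH c g h cn c0 f0 E.
case: (const_step c0) => [cU|[q [c' [qP Ec c'0 dc]]]].
  exists (c^-1%:P * g), h; split=> //.
    by rewrite -mulrA -E mulrA -polyCM mulVr // mul1r.
  by rewrite mul_polyC size_scale // invr_eq0.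
have [q0 _ _] := qP.
have : rdvd q%:P (g * h) by rewrite -E Ec polyCM mulrAC; apply: rdvd_mull; exists 1; rewrite mul1r.
have sq k : size (k * q%:P) = size k by rewrite mulrC mul_polyC size_scale.
case/(prime_polyC qP) => -[k Ek].
  case: (IH c' k h) => //; first by have := dc d dA; lia.
    by apply: (cancelC q0); rewrite mulrAC -polyCM -Ec E Ek mulrAC.
  by move=> g' [h' [Ef sg sh]]; exists g', h'; rewrite Ek sq.
case: (IH c' g k) => //; first by have := dc d dA; lia.
  by apply: (cancelC q0); rewrite mulrAC -polyCM -Ec E Ek mulrA.
by move=> g' [h' [Ef sg sh]]; exists g', h'; rewrite Ek sq.
Qed.

Let primitive f q : irreducible_elt f -> (1 < size f)%N -> prime_elt q -> ~ rdvd q%:P f.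
Proof.
move=> [f0 fU fI] sf [q0 qU _] [g E].
have /fI[] : f = g * q%:P by [].
  rewrite poly_unitE => /andP[/eqP sg _].
  by move: sf; rewrite E mulrC mul_polyC size_scale // sg.
by rewrite poly_unitE coefC /= (negbTE qU) andbF.
Qed.

(** For nonconstant [f], compare [f] and [a] by their gcd over the fraction field. If it is
    constant, [f] divides [b] up to a constant; otherwise irreducibility makes it [f] up to
    constants, so [f] divides [a] up to a constant. [strip_divisor] removes the constants. *)
Lemma irreducible_poly_prime f : irreducible_elt f -> prime_elt f.
Proof.
move=> fI; have [f0 fU _] := fI; split=> // a b fab.
have [sf|sf] := leqP (size f) 1.
  have [c Ef] : exists c, f = c%:P by exists f`_0; apply: size1_polyC.
  rewrite Ef in fab *; apply: prime_polyC fab; apply: Afact.2.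
  rewrite Ef in fI; have [c0 cU cI] := fI; split.
  - by rewrite polyC_eq0 in c0.
  - by move: cU; rewrite poly_unitE size_polyC coefC /= (_ : c != 0) //; rewrite polyC_eq0 in c0.
  move=> q s E; case: (cI q%:P s%:P); first by rewrite E polyCM.
    by rewrite poly_unitE coefC /= => /andP[_]; left.
  by rewrite poly_unitE coefC /= => /andP[_]; right.
have fprim := primitive fI sf.
have [m Em] := fab.
have [->|a0] := eqVneq a 0; first by left; apply: rdvd0.
pose g := gcdp f a.
have g0 : g != 0 by rewrite gcdp_eq0 negb_and f0.
have [sg|sg] := eqVneq (size g) 1%N.
  right; have cop : coprimep f a by rewrite coprimep_def sg.
  have : f %| a * b.
    by rewrite Em dvdp_mull.
  rewrite (Gauss_dvdpr _ cop) => /Pdiv.Idomain.dvdpP[[c h] /= c0 E].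
  by apply: (strip_divisor c0 fprim (h := h)); rewrite mul_polyC.
left.
have /Pdiv.Idomain.dvdpP[[c h] /= c0 Ef] : g %| f by apply: dvdp_gcdl.
have /Pdiv.Idomain.dvdpP[[k l] /= k0 Ea] : g %| a by apply: dvdp_gcdr.
have [|g' [h' [Efs sg' sh']]] := strip_product (c := c) (g := g) (h := h) c0 f0.
  by rewrite mul_polyC Ef mulrC.
have sg2 : (1 < size g)%N by rewrite ltn_neqAle eq_sym sg lt0n size_poly_eq0.
have [_ _ /(_ _ _ Efs)[|]] := fI; rewrite poly_unitE => /andP[/eqP s1 _].
  by move: sg2; rewrite -sg' s1.
have [q Eh] : exists q, h = q%:P by exists h`_0; apply: size1_polyC; rewrite -sh' s1.
have q0 : q != 0.
  by apply: contra_neq f0 => q0; move/eqP: Ef; rewrite Eh q0 polyC0 mul0r -mul_polyC mulf_eq0 polyC_eq0 (negbTE c0) => /eqP.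
apply: (strip_divisor (c := k * q) (h := c%:P * l)) => //; first by rewrite mulf_neq0.
rewrite polyCM -mulrA (mulrC q%:P) mulrA mul_polyC Ea -!mulrA (mulrC g) -Eh -Ef.
by rewrite -mul_polyC mulrCA.
Qed.

Lemma factorial_poly : factorial {poly A}.
Proof.
split; last exact: irreducible_poly_prime.
(* The term for the leading coefficient ensures that size zero forces a constant that is a unit of
   [A]. *)
have [[d dA] _] := Afact; exists (fun f => (size f).-1 + d (lead_coef f))%N; split.
  move=> f g f0 g0; rewrite lead_coefM dA.1 ?lead_coef_eq0 // size_mul //.
  by move: f0 g0; rewrite -!size_poly_gt0; lia.
move=> f f0 /eqP; rewrite addn_eq0 => /andP[/eqP s1 /eqP dl].
have sf : size f = 1%N by move: f0; rewrite -size_poly_gt0; lia.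
rewrite poly_unitE sf eqxx /=; have := dA.2 _ _ dl; rewrite lead_coef_eq0 => /(_ f0).
by rewrite lead_coefE sf.
Qed.

End PolyFactorial.

Lemma factorial_field (F : fieldType) : factorial F.
Proof.
split; last by move=> p [p0]; rewrite unitfE p0.
by exists (fun=> 0%N); split=> // a a0 _; rewrite unitfE.
Qed.

Lemma size_det_leq (A : idomainType) m n (M : 'M[{poly A}]_m) :
  (forall i j, (size (M i j) <= n.+1)%N) -> (size (\det M) <= (m * n).+1)%N.
Proof.
move=> Mn; apply: leq_trans (size_sum _ _ _) _; apply/bigmax_leqP => s _.
rewrite -signr_odd mulr_sign; case: ifP => _; rewrite ?size_polyN.
all: apply: leq_trans (size_prod_leq _ _) _; rewrite leq_subLR card_ord addnS ltnS.
all: apply: (@leq_trans (\sum_(i < m) n.+1)); first exact: leq_sum.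
all: by rewrite sum_nat_const card_ord mulnS.
Qed.

(** * Resultants and common zeros *)

Section Elimination.
Variable A : idomainType.
Hypothesis Afact : factorial A.
Implicit Types P Q : {poly {poly A}}.

(** By primality, a common factor of positive degree would be a constant multiple of both [P] and
    [Q], and [P] would divide [Q]. *)
Let irreducible_gcd P Q : irreducible_elt P -> irreducible_elt Q -> ~ rdvd P Q ->
  (1 < size P)%N -> (1 < size Q)%N -> (size (gcdp P Q) <= 1)%N.
Proof.
move=> PI QI nPQ sP sQ; rewrite leqNgt; apply/negP => sg.
set g := gcdp P Q in sg.
have g0 : g != 0 by rewrite -size_poly_gt0; apply: ltn_trans sg.
have key F : irreducible_elt F -> g %| F -> exists c : {poly A}, g = c%:P * F.
  move=> FI /Pdiv.Idomain.dvdpP[[c h] /= c0 E].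
  have [F0 _ FP] := irreducible_poly_prime (factorial_poly Afact) FI.
  have h0 : h != 0.
    apply: contra_neq F0 => h0; move/eqP: E.
    by rewrite h0 mul0r -mul_polyC mulf_eq0 polyC_eq0 (negbTE c0) => /eqP.
  have sE : size F = (size h + size g).-1 by rewrite -size_mul // -E size_scale.
  have : rdvd F (h * g) by rewrite -E -mul_polyC; apply: rdvd_mull; exists 1; rewrite mul1r.
  case/FP => [[c' Eh]|[c' Eg]].
    have c'0 : c' != 0 by apply: contra_neq h0; rewrite Eh => ->; rewrite mul0r.
    exfalso; move: sE; rewrite Eh size_mul //; move: F0 c'0; rewrite -!size_poly_gt0.
    by move: sg; move: (size F) (size c') (size g) => x y z; lia.
  have c'0 : c' != 0 by apply: contra_neq g0; rewrite Eg => ->; rewrite mul0r.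
  exists c'`_0; rewrite -size1_polyC //.
  move: sE; rewrite [in X in X -> _]Eg size_mul //; move: F0 c'0 h0.
  by rewrite -!size_poly_gt0; move: (size F) (size c') (size h) => x y z; lia.
have [a Ea] := key _ PI (dvdp_gcdl _ _).
have [b Eb] := key _ QI (dvdp_gcdr _ _).
have [P0 _ PP] := irreducible_poly_prime (factorial_poly Afact) PI.
have : rdvd P (b%:P * Q) by rewrite -Eb Ea; apply: rdvd_mull; exists 1; rewrite mul1r.
case/PP => // -[c Ec].
have b0 : b != 0 by apply: contra_neq g0; rewrite Eb => ->; rewrite mul0r.
have c0 : c != 0.
  by apply: contra_neq b0 => c0; apply/eqP; rewrite -polyC_eq0 Ec c0 mul0r.
have := congr1 (fun f : {poly {poly A}} => size f) Ec; rewrite size_polyC b0 size_mul //=.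
by move: c0 sP; rewrite -size_poly_gt0; move: (size c) (size P) => x y; lia.
Qed.

(** The witness is the resultant, a determinant of order at most [2 n] with entries of degree at
    most [n]; a polynomial constant in the outer variable is its own witness. *)
Lemma elimination P Q n : irreducible_elt P -> irreducible_elt Q -> ~ rdvd P Q ->
  (0 < n)%N -> (size P <= n.+1)%N -> (size Q <= n.+1)%N ->
  (forall i, size (P`_i)%R <= n.+1)%N -> (forall i, size (Q`_i)%R <= n.+1)%N ->
  exists r : {poly A}, [/\ r != 0, (size r <= (n.*2 * n).+1)%N &
    exists u v, r%:P = u * P + v * Q].
Proof.
move=> PI QI nPQ n0 sP sQ cP cQ; have [[P0 _ _] [Q0 _ _]] := (PI, QI).
have n2 : (n <= n.*2 * n)%N by rewrite leq_pmull // double_gt0.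
have [sP1|sP1] := leqP (size P) 1.
  have EP := size1_polyC sP1; exists P`_0; split.
  - by rewrite -polyC_eq0 -EP.
  - exact: leq_trans (cP 0%N) _.
  by exists 1, 0; rewrite mul0r addr0 mul1r -EP.
have [sQ1|sQ1] := leqP (size Q) 1.
  have EQ := size1_polyC sQ1; exists Q`_0; split.
  - by rewrite -polyC_eq0 -EQ.
  - exact: leq_trans (cQ 0%N) _.
  by exists 0, 1; rewrite mul0r add0r mul1r -EQ.
exists (resultant P Q); split.
- by rewrite resultant_eq0 -leqNgt irreducible_gcd.
- apply: leq_trans (size_det_leq (n := n) _) _ => [i j|].
    rewrite Sylvester_mxE; case: (fintype.split i) => l; case: (l <= _)%N;
    by rewrite ?mulr1n ?mulr0n ?size_poly0.
  rewrite ltnS leq_mul2r; apply/orP; right; rewrite -addnn.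
  by move: sP sQ sP1 sQ1; move: (size P) (size Q) => x y; lia.
by have [[u v] _ ->] := resultant_in_ideal sP1 sQ1; exists u, v.
Qed.

End Elimination.

(** Eliminating either variable confines each coordinate of a common zero to the roots of one
    nonzero polynomial. The base is a ring so that a line can later be a point over the polynomials
    in its parameter. *)
Lemma common_zeros (A : idomainType) (P Q : {poly {poly A}}) n (pts : seq (A * A)) :
  factorial A -> irreducible_elt P -> irreducible_elt Q -> ~ rdvd P Q -> (0 < n)%N ->
  (forall i j, (n < i)%N || (n < j)%N -> P`_i`_j = 0) ->
  (forall i j, (n < i)%N || (n < j)%N -> Q`_i`_j = 0) ->
  uniq pts ->
  (forall p, p \in pts -> P.[p.1%:P].[p.2] = 0 /\ Q.[p.1%:P].[p.2] = 0) ->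
  (size pts <= (n.*2 * n) ^ 2)%N.
Proof.
move=> Afact PI QI nPQ n0 Pn Qn upts ptsP.
have swap_irr (F : {poly {poly A}}) : irreducible_elt F -> irreducible_elt (swapXY F).
  have swapU (f : {poly {poly A}}) : (swapXY f \is a GRing.unit) = (f \is a GRing.unit).
    have sub (g : {poly {poly A}}) : g \is a GRing.unit -> swapXY g \is a GRing.unit.
      by move=> gU; apply/unitrP; exists (swapXY g^-1); rewrite -!rmorphM mulVr // mulrV // rmorph1.
    by apply/idP/idP => /sub //; rewrite swapXYK.
  move=> [F0 FU FI]; split; [by rewrite swapXY_eq0 | by rewrite swapU |].
  move=> q s E; have /FI : F = swapXY q * swapXY s by rewrite -rmorphM /= -E swapXYK.
  by rewrite !swapU.
have swap_dvd : ~ rdvd (swapXY P) (swapXY Q).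
  case=> c E; apply: nPQ; exists (swapXY c).
  by rewrite -[P]swapXYK -rmorphM /= -E swapXYK.
have bounds (F : {poly {poly A}}) : (forall i j, (n < i)%N || (n < j)%N -> F`_i`_j = 0) ->
    (size F <= n.+1)%N /\ (forall i, size (F`_i)%R <= n.+1)%N.
  move=> h; split=> [|i]; apply/leq_sizeP => j nj; last by rewrite h // nj orbT.
  by apply/polyP => l; rewrite h ?nj // coef0.
have [[sP cP] [sQ cQ]] := (bounds _ Pn, bounds _ Qn).
have Pn' i j : (n < i)%N || (n < j)%N -> (swapXY P)`_i`_j = 0.
  by move=> h; rewrite coef_swapXY Pn // orbC.
have Qn' i j : (n < i)%N || (n < j)%N -> (swapXY Q)`_i`_j = 0.
  by move=> h; rewrite coef_swapXY Qn // orbC.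
have [[sP' cP'] [sQ' cQ']] := (bounds _ Pn', bounds _ Qn').
have [r [r0 sr [u [v E]]]] := elimination Afact PI QI nPQ n0 sP sQ cP cQ.
have [r' [r'0 sr' [u' [v' E']]]] :=
  elimination Afact (swap_irr _ PI) (swap_irr _ QI) swap_dvd n0 sP' sQ' cP' cQ'.
have rootr p : p \in pts -> root r p.2.
  case/ptsP => Pp Qp; rewrite rootE; have := congr1 (fun f => f.[p.1%:P].[p.2]) E.
  by rewrite hornerC => ->; rewrite !hornerE Pp Qp !mulr0 addr0.
have rootr' p : p \in pts -> root r' p.1.
  case/ptsP => Pp Qp; rewrite rootE; have := congr1 (fun f => f.[p.2%:P].[p.1]) E'.
  rewrite hornerC => ->; rewrite !hornerE.
  by rewrite !horner2_swapXY Pp Qp !mulr0 addr0.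
pose s1 := undup (map fst pts); pose s2 := undup (map snd pts).
have l1 : (size s1 <= n.*2 * n)%N.
  rewrite -ltnS; apply: leq_trans sr'; apply: max_poly_roots => //; last exact: undup_uniq.
  by apply/allP => a; rewrite mem_undup => /mapP[p pp ->]; apply: rootr'.
have l2 : (size s2 <= n.*2 * n)%N.
  rewrite -ltnS; apply: leq_trans sr; apply: max_poly_roots => //; last exact: undup_uniq.
  by apply/allP => a; rewrite mem_undup => /mapP[p pp ->]; apply: rootr.
apply: (@leq_trans (size [seq (a, b) | a <- s1, b <- s2])).
  apply: uniq_leq_size => // -[a b] ab; apply/allpairsP; exists (a, b).
  by rewrite !mem_undup /=; split=> //; apply/mapP; exists (a, b).
by rewrite size_allpairs -mulnn leq_mul.
Qed.

Section BijectiveMorphism.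
Variables (A B : idomainType) (f : {rmorphism A -> B}).
Hypothesis (f_inj : injective f) (f_surj : forall b, exists a, f a = b).

Lemma bij_unit a : (f a \is a GRing.unit) = (a \is a GRing.unit).
Proof.
apply/idP/idP => [/unitrP[b [ba ab]]|]; last exact: rmorph_unit.
have [c Ec] := f_surj b; apply/unitrP; exists c.
by split; apply: f_inj; rewrite rmorphM rmorph1 Ec.
Qed.

Lemma bij_irreducible a : irreducible_elt a -> irreducible_elt (f a).
Proof.
move=> [a0 aU aI]; split; first by rewrite raddf_eq0.
  by rewrite bij_unit.
move=> q s; have [[q' <-] [s' <-]] := (f_surj q, f_surj s).
by rewrite -rmorphM => /f_inj /aI; rewrite !bij_unit.
Qed.

Lemma bij_rdvd a b : rdvd (f a) (f b) -> rdvd a b.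
Proof.
by case=> c; have [c' <-] := f_surj c; rewrite -rmorphM => /f_inj ->; exists c'.
Qed.

End BijectiveMorphism.

Lemma rmorph_mmap n (R S T : comRingType) (g : {rmorphism S -> T}) (f : R -> S)
    (h : 'I_n -> S) p :
  g (mmap f h p) = mmap (g \o f) (g \o h) p.
Proof.
rewrite /mmap rmorph_sum; apply: eq_bigr => m _; rewrite rmorphM /=; congr (_ * _).
by rewrite /mmap1 rmorph_prod; apply: eq_bigr => i _; rewrite rmorphXn.
Qed.

(** * Three variables as iterated univariate polynomials *)

Section NestedPoly.
Variable R : fieldType.

Definition coefC3 : R -> {poly {poly {poly R}}} := polyC \o polyC \o polyC.

HB.instance Definition _ := GRing.RMorphism.copy coefC3 (polyC \o polyC \o polyC).

(** Variable 0, the future parameter of lines, is innermost, so that it belongs to the base ring of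
    the elimination. *)
Definition nested_var (i : 'I_3) : {poly {poly {poly R}}} :=
  nth 0 [:: 'X%:P%:P; 'X%:P; 'X] i.

Definition nested : mpoly 3 R -> {poly {poly {poly R}}} := mmap coefC3 nested_var.

HB.instance Definition _ := GRing.RMorphism.copy nested (mmap coefC3 nested_var).

Definition mnm3 i j k : multinom 3 := Multinom [tuple i; j; k].

Lemma coef_nested p i j k : (nested p)`_k`_j`_i = mcoeff (mnm3 i j k) p.
Proof.
rewrite {2}[p]mpolyE raddf_sum /= /nested /mmap !coef_sum; apply: eq_bigr => m _.
rewrite mcoeffZ mcoeffX /mmap1 !big_ord_recl big_ord0 mulr1 /nested_var /=.
rewrite -!rmorphXn /= /coefC3 /=.
set a := m _; set b := m _; set c := m _.
have -> : (m == mnm3 i j k) = [&& i == a, j == b & k == c].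
  apply/eqP/and3P => [E|[/eqP-> /eqP-> /eqP->]].
    by rewrite /a /b /c E; split; apply/eqP; rewrite multinomE.
  apply/mnmP => l; rewrite multinomE (tnth_nth 0%N) /=.
  case: l => -[|[|[|//]]] hl /=; congr (m _); exact: val_inj.
rewrite !coefCM coefXn; case: (k == c); last first.
  by rewrite !(andbF, mulr0, coef0).
rewrite !andbT mulr1 coefXn; case: (j == b); last first.
  by rewrite !(andbF, mulr0, coef0).
by rewrite !andbT mulr1 coefXn.
Qed.

Lemma nested_inj : injective nested.
Proof.
move=> p q E; apply/mpolyP => m; have := coef_nested p (m ord0) (m (inord 1)) (m (inord 2)).
rewrite E coef_nested; set m' := mnm3 _ _ _; suff -> : m' = m by [].
apply/mnmP => l; rewrite multinomE (tnth_nth 0%N) /=.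
by case: l => -[|[|[|//]]] hl /=; congr (m _); apply: val_inj; rewrite //= inordK.
Qed.

Lemma nested_surj F : exists p, nested p = F.
Proof.
have nestC c : nested (mpolyC 3 c) = coefC3 c by rewrite /nested mmapC.
have nestX i : nested (mpolyX R (mnm1 i)) = nested_var i.
  by rewrite /nested mmapX mmap1U.
have imM G H : (exists p, nested p = G) -> (exists p, nested p = H) ->
    exists p, nested p = G * H.
  by move=> [p <-] [q <-]; exists (p * q); rewrite rmorphM.
have imD G H : (exists p, nested p = G) -> (exists p, nested p = H) ->
    exists p, nested p = G + H.
  by move=> [p <-] [q <-]; exists (p + q); rewrite raddfD.
have imX i : exists p, nested p = nested_var i by exists (mpolyX R (mnm1 i)).
have im2 : exists p, nested p = 'X by have := imX (@Ordinal 3 2 isT).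
have im1 : exists p, nested p = 'X%:P by have := imX (@Ordinal 3 1 isT).
have im0 : exists p, nested p = 'X%:P%:P by have := imX (@Ordinal 3 0 isT).
elim/poly_ind: F => [|F G IH]; first by exists 0; rewrite raddf0.
apply: (imD); first exact: (imM).
elim/poly_ind: G => [|G H IHG]; first by exists 0; rewrite raddf0.
rewrite polyCD polyCM; apply: (imD); first exact: (imM).
elim/poly_ind: H => [|H c IHH]; first by exists 0; rewrite raddf0.
rewrite !polyCD !polyCM; apply: (imD); first exact: (imM).
by exists (mpolyC 3 c); rewrite nestC.
Qed.

Lemma horner_nested p (a b : {poly R}) t :
  (nested p).[b%:P].[a].[t] = meval (fun i : 'I_3 => nth 0 [:: t; a.[t]; b.[t]] i) p.
Proof.
rewrite -[LHS]/(horner_eval t (horner_eval a (horner_eval b%:P (nested p)))).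
rewrite /nested !rmorph_mmap mevalE /mmap; apply: eq_bigr => m _.
rewrite /coefC3 /= /horner_eval !hornerC; congr (_ * _); apply: eq_bigr => i _.
by congr (_ ^+ _); case: i => -[|[|[|//]]] hi; rewrite /nested_var /= !hornerE.
Qed.

Lemma coef_nested_eq0 n p : (msize p <= n.+1)%N ->
  forall i j, (n < i)%N || (n < j)%N -> (nested p)`_i`_j = 0.
Proof.
move=> pn k j kj; apply/polyP => i; rewrite coef0 coef_nested.
apply/eqP; rewrite mcoeff_eq0; apply: msize_mdeg_ge; apply: leq_trans pn _.
rewrite mdegE !big_ord_recl big_ord0 !multinomE !(tnth_nth 0%N) /=.
by case/orP: kj; lia.
Qed.

End NestedPoly.

Lemma meval_msym (R : comRingType) n (s : 'S_n) (v : 'I_n -> R) p :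
  meval v (msym s p) = meval (v \o s) p.
Proof.
rewrite /msym rmorph_mmap /meval /mmap; apply: eq_bigr => m _.
rewrite /= mevalC; congr (_ * _); apply: eq_bigr => i _.
by rewrite /= mevalXU.
Qed.

Lemma poly_eval0 (R : numFieldType) (p : {poly R}) : (forall t, p.[t] = 0) -> p = 0.
Proof.
move=> p0; apply: (roots_geq_poly_eq0 (rs := [seq i%:R | i <- iota 0 (size p)])).
- by apply/allP => x _; rewrite rootE p0.
- by rewrite map_inj_uniq ?iota_uniq // => i j /eqP; rewrite eqr_nat => /eqP.
- by rewrite size_map size_iota.
Qed.

(** * Lines common to two surfaces *)

Section Lines.
Variable R : realType.
Implicit Types (l : set 'rV[R]_3) (P Q : mpoly 3 R).

(** Coordinate [i] is the parameter; [ab] is then a point with polynomial coordinates. *)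
Definition graph_line (i : 'I_3) (ab : {poly R} * {poly R}) : set 'rV[R]_3 :=
  let s := tperm ord0 i in
  [set x | x ord0 (s (inord 1)) = ab.1.[x ord0 i] /\
           x ord0 (s (inord 2)) = ab.2.[x ord0 i]].

Lemma line_is_graph l : is_line l -> exists i ab, l = graph_line i ab.
Proof.
move=> [p [v [v0 ->]]].
have [i vi] : exists i, v ord0 i != 0.
  apply: contrapT => no; case/eqP: v0; apply/rowP => i; rewrite mxE.
  by apply: contrapT => /eqP vi; apply: no; exists i.
pose s := tperm ord0 i.
pose slope k := v ord0 (s k) / v ord0 i.
pose f k : {poly R} := (p ord0 (s k) - slope k * p ord0 i)%:P + slope k *: 'X.
have fE k t : (f k).[p ord0 i + t * v ord0 i] = p ord0 (s k) + t * v ord0 (s k).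
  rewrite /f !hornerE /slope mulrDr; field; exact: vi.
exists i, (f (inord 1), f (inord 2)); apply/seteqP; split=> [x [t _ <-]|x [/= x1 x2]].
  by split; rewrite /= !mxE fE.
pose t := (x ord0 i - p ord0 i) / v ord0 i.
have xi : x ord0 i = p ord0 i + t * v ord0 i by rewrite /t divfK // addrC subrK.
exists t => //; apply/rowP => j; rewrite !mxE.
have [k ->] : exists k, j = s k by exists (s j); rewrite tpermK.
case: (ltngtP k 1%N) => k1.
- have -> : k = ord0 by apply: val_inj => /=; case: (val k) k1.
  by rewrite tpermL.
- have -> : k = inord 2 by apply: val_inj; rewrite /= inordK //; have := ltn_ord k; lia.
  by rewrite x2 xi fE.
- have -> : k = inord 1 by apply: val_inj; rewrite /= inordK.
  by rewrite x1 xi fE.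
Qed.

Lemma zero_set_dvd P Q : irreducible_elt P -> irreducible_elt Q -> rdvd P Q ->
  zero_set P = zero_set Q.
Proof.
move=> PI QI PQ; have sub P' Q' : rdvd P' Q' -> zero_set P' `<=` zero_set Q'.
  by case=> c -> x /= x0; rewrite /zero_set /= mevalM x0 mulr0.
by apply/seteqP; split; apply: sub => //; apply: rdvd_irreducible PQ.
Qed.

(** After exchanging coordinates [0] and [i], each line becomes a common zero of two bivariate
    polynomials over the ring of polynomials in the parameter, and [common_zeros] applies. *)
Lemma common_graph_lines P Q n (i : 'I_3) (Ls : seq (set 'rV[R]_3)) : (0 < n)%N ->
  irreducible_elt P -> irreducible_elt Q -> ~ rdvd P Q ->
  (msize P <= n.+1)%N -> (msize Q <= n.+1)%N -> uniq Ls ->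
  (forall l, l \in Ls -> [/\ exists ab, l = graph_line i ab, l `<=` zero_set P & l `<=` zero_set Q]) ->
  (size Ls <= (n.*2 * n) ^ 2)%N.
Proof.
move=> n0 PI QI nPQ sP sQ uL LP.
pose s := tperm ord0 i.
pose g : {rmorphism mpoly 3 R -> mpoly 3 R} := msym s.
have msymK : involutive (msym s : mpoly 3 R -> mpoly 3 R).
  by move=> p; rewrite -msymMm tperm2 msym1m.
pose f : {rmorphism mpoly 3 R -> {poly {poly {poly R}}}} := @nested R \o g.
have f_inj : injective f by move=> p q /nested_inj; apply: inj_msym.
have f_surj F : exists p, f p = F.
  by have [p <-] := nested_surj F; exists (g p); rewrite /f /= msymK.
have msize_sym p : (msize p <= n.+1)%N -> (msize (g p) <= n.+1)%N.
  move=> pn; rewrite msizeE; apply/bigmax_leqP_seq => m mp _.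
  move: mp; rewrite mcoeff_msupp mcoeff_sym -mcoeff_msupp => /msize_mdeg_lt mp.
  apply: leq_trans pn; apply: leq_trans mp; rewrite ltnS.
  rewrite !mdegE (reindex_inj (@perm_inj _ s)) /=.
  by rewrite leq_eqVlt; apply/orP; left; apply/eqP; apply: eq_bigr => j _; rewrite mnmE.
have [h hE] : exists h : set 'rV[R]_3 -> {poly R} * {poly R},
    forall l, l \in Ls -> l = graph_line i (h l).
  have : forall l, exists ab, l \in Ls -> l = graph_line i ab.
    move=> l; case lL: (l \in Ls); last by exists (0, 0).
    by have [[ab ->] _ _] := LP _ lL; exists ab.
  by case/choice => h hE; exists h.
have vanish p l : l \in Ls -> l `<=` zero_set p -> (f p).[(h l).2%:P].[(h l).1] = 0.
  move=> lL lp; apply: poly_eval0 => t; rewrite horner_nested /= meval_msym.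
  pose w (k : 'I_3) := nth 0 [:: t; (h l).1.[t]; (h l).2.[t]] k.
  pose x : 'rV[R]_3 := \row_k w (s k).
  have : l x.
    have x0 : x ord0 i = t by rewrite mxE tpermR.
    have xs k : x ord0 (s k) = w k by rewrite mxE tpermK.
    by rewrite (hE _ lL); split; rewrite /= x0 xs /w inordK.
  move/lp; rewrite /zero_set /= => xp; rewrite -[RHS]xp.
  by apply: meval_eq => k; rewrite mxE.
(* The pair is reversed because the outer variable is the one of index 2. *)
rewrite -(size_map (fun l => ((h l).2, (h l).1))).
apply: (common_zeros (P := f P) (Q := f Q)) n0 _ _ _ _.
- exact/factorial_poly/factorial_field.
- exact: bij_irreducible.
- exact: bij_irreducible.
- by move=> /(bij_rdvd f_inj f_surj).
- exact/coef_nested_eq0/msize_sym.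
- exact/coef_nested_eq0/msize_sym.
- rewrite map_inj_in_uniq // => l l' lL l'L [E2 E1].
  by rewrite (hE _ lL) (hE _ l'L); move: E1 E2; case: (h l) (h l') => [a b] [a' b'] /= -> ->.
by move=> p /mapP[l lL ->]; have [_ lP lQ] := LP _ lL; split; apply: vanish.
Qed.

(** Every line is a graph over one of three coordinates, whence the factor 3. *)
Lemma common_lines P Q n (Ls : seq (set 'rV[R]_3)) : (0 < n)%N ->
  irreducible_elt P -> irreducible_elt Q -> zero_set P <> zero_set Q ->
  (msize P <= n.+1)%N -> (msize Q <= n.+1)%N -> uniq Ls ->
  (forall l, l \in Ls -> [/\ is_line l, l `<=` zero_set P & l `<=` zero_set Q]) ->
  (size Ls <= 3 * (n.*2 * n) ^ 2)%N.
Proof.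
move=> n0 PI QI nPQ sP sQ uL LP.
have npq : ~ rdvd P Q by move=> PQ; apply/nPQ/zero_set_dvd.
pose isg i l := `[< exists ab, l = graph_line i ab >].
have cover : (size Ls <= \sum_(i < 3) size (filter (isg i) Ls))%N.
  under eq_bigr do rewrite size_filter -sum1_count big_mkcond.
  rewrite exchange_big /= -sum1_size big_seq [leqRHS]big_seq; apply: leq_sum => l lL.
  have [/line_is_graph[i [ab E]] _ _] := LP _ lL.
  by rewrite (bigD1 i) //= (_ : isg i l) //; apply/asboolP; exists ab.
apply: leq_trans cover _; rewrite -[X in (_ <= X * _)%N](card_ord 3) -sum_nat_const.
apply: leq_sum => i _; apply: (common_graph_lines (i := i) n0 PI QI) => //.
  exact: filter_uniq.
by move=> l; rewrite mem_filter => /andP[/asboolP il /LP[_ lP lQ]].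
Qed.

End Lines.

(** * Polynomial partitioning *)

Section Partition.
Variable R : realType.
Local Notation point := 'rV[R]_3.
Implicit Types (x : point) (P Q : mpoly 3 R) (Ps : seq (mpoly 3 R)) (S : seq point).

Definition pev P x : R := meval (fun i => x ord0 i) P.

(** Exponents all below [d]: a space of dimension [d ^ 3] whose degrees stay below [3 d]. *)
Let box d := ('I_d * 'I_d * 'I_d)%type.

Let expo d (k : 'I_#|{: box d}|) : multinom 3 :=
  let e := enum_val k in mnm3 e.1.1 e.1.2 e.2.

Let box_poly d (u : 'rV[R]_#|{: box d}|) : mpoly 3 R :=
  \sum_k u ord0 k *: mpolyX R (expo k).

Let expo_inj d : injective (@expo d).
Proof.
move=> k l /mnmP E; apply: enum_val_inj.
have := (E ord0, E (inord 1), E (inord 2)).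
rewrite /expo !multinomE !(tnth_nth 0%N) /= !inordK //=.
case: (enum_val k) (enum_val l) => [[a b] c] [[a' b'] c'] /= [[h1 h2] h3].
by congr (_, _, _); apply: val_inj.
Qed.

Let box_poly_neq0 d (u : 'rV[R]_#|{: box d}|) : u != 0 -> box_poly u != 0.
Proof.
apply: contra => /eqP u0; apply/eqP/rowP => k; rewrite mxE.
have := congr1 (mcoeff (expo k)) u0; rewrite mcoeff0 raddf_sum (bigD1 k) //=.
rewrite mcoeffZ mcoeffX eqxx mulr1 big1 ?addr0 // => l lk.
by rewrite mcoeffZ mcoeffX (inj_eq (@expo_inj d)) (negbTE lk) mulr0.
Qed.

Let msize_box_poly d (u : 'rV[R]_#|{: box d}|) : (0 < d)%N -> (msize (box_poly u) <= 3 * d)%N.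
Proof.
move=> d0; rewrite msizeE; apply/bigmax_leqP_seq => m + _.
rewrite mcoeff_msupp /box_poly raddf_sum /= => m0.
have [k ->] : exists k : 'I_#|{: box d}|, m = expo k.
  apply: contrapT => nk; case/eqP: m0; apply: big1 => k _.
  rewrite mcoeffZ mcoeffX; case: eqP => [E|]; last by rewrite mulr0.
  by case: nk; exists k.
rewrite mdegE !big_ord_recl big_ord0 /expo !multinomE !(tnth_nth 0%N) /=.
by case: (enum_val k) => [[a b] c] /=; move: (ltn_ord a) (ltn_ord b) (ltn_ord c); lia.
Qed.

Lemma bisecting_poly d (A : seq (seq point)) : (size A < d ^ 3)%N ->
  exists P, [/\ P != 0, (msize P <= 3 * d)%N & forall S, S \in A ->
    ((count (fun x => 0 < pev P x)%R S).*2 <= size S)%N /\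
    ((count (fun x => pev P x < 0)%R S).*2 <= size S)%N].
Proof.
move=> Ad; have d0 : (0 < d)%N by case: d Ad.
have card_box : #|{: box d}| = (d ^ 3)%N.
  by rewrite !card_prod !card_ord !expnS expn0 muln1 mulnA.
rewrite -card_box in Ad.
have lin x a b (v w : 'rV[R]_#|{: box d}|) :
    pev (box_poly (a *: v + b *: w)) x = a * pev (box_poly v) x + b * pev (box_poly w) x.
  rewrite /pev -!mevalZ -mevalD; congr meval; rewrite /box_poly !scaler_sumr -big_split.
  by apply: eq_bigr => k _ /=; rewrite !mxE scalerDl !scalerA.
have [u u0 uA] := ham_sandwich (ev := fun x u => pev (box_poly u) x) lin Ad.
by exists (box_poly u); split; [exact: box_poly_neq0 | exact: msize_box_poly |].
Qed.

Definition cell Ps (b : bitseq) x :=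
  all (fun P => pev P x != 0) Ps && (map (fun P => 0 < pev P x) Ps == b).

Lemma cell_size Ps b x : cell Ps b x -> size b = size Ps.
Proof. by case/andP => _ /eqP <-; rewrite size_map. Qed.

Definition equipartition m Ps S :=
  size Ps = m /\ forall b, (2 ^ m * count (cell Ps b) S <= size S)%N.

(** All [2 ^ m] cells are bisected at once; sign patterns of the wrong length give empty cells. *)
Lemma equipartition_step m d Ps S : equipartition m Ps S -> (2 ^ m < d ^ 3)%N ->
  exists P, [/\ P != 0, (msize P <= 3 * d)%N & equipartition m.+1 (P :: Ps) S].
Proof.
move=> [sPs PsS] md.
pose A := [seq filter (cell Ps (val b)) S | b : m.-tuple bool].
have sA : (size A < d ^ 3)%N by rewrite size_map -cardT card_tuple card_bool.
have [P [P0 Pd PA]] := bisecting_poly sA.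
exists P; split=> //; split=> [|b]; first by rewrite /= sPs.
case: b => [|c b].
  rewrite (@eq_count _ _ pred0) ?count_pred0 ?muln0 // => x.
  by apply/negP => /cell_size.
have [sb|sb] := eqVneq (size b) m; last first.
  rewrite (@eq_count _ _ pred0) ?count_pred0 ?muln0 // => x.
  by apply/negP => /cell_size /= [E]; rewrite E sPs eqxx in sb.
have /PA[hp hn] : filter (cell Ps b) S \in A.
  have tb : size b == m by apply/eqP.
  by apply/mapP; exists (Tuple tb); rewrite ?mem_enum.
apply: leq_trans (PsS b); rewrite expnS -mulnA mulnCA leq_mul2l mul2n; apply/orP; right.
rewrite -[X in (_ <= X)%N]size_filter; case: c.
  rewrite (@eq_count _ _ (predI (fun x => 0 < pev P x) (cell Ps b))) => [|x].
    by rewrite -count_filter.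
  by rewrite /cell /= eqseq_cons; case: ltgtP => //=; rewrite ?andbF.
rewrite (@eq_count _ _ (predI (fun x => pev P x < 0) (cell Ps b))) => [|x].
  by rewrite -count_filter.
by rewrite /cell /= eqseq_cons; case: ltgtP => //=; rewrite ?andbF.
Qed.

(** Three bisections with [d = 2 ^ J.+1] multiply the number of cells by 8 and add at most
    [9 d = 18 * 2 ^ J] to the degree, so the degree bound just doubles. *)
Lemma equipartition_exists J S : exists Ps,
  [/\ all (fun P => P != 0) Ps, (\sum_(P <- Ps) (msize P).-1 <= 18 * 2 ^ J)%N
    & equipartition (3 * J) Ps S].
Proof.
elim: J => [|J [Ps [Ps0 dPs PsS]]].
  exists [::]; split=> //; first by rewrite big_nil.
  by split=> // b; rewrite muln0 expn0 mul1n count_size.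
have lt k : (k < 3)%N -> (2 ^ (3 * J + k) < (2 ^ J.+1) ^ 3)%N.
  by move=> k3; rewrite -expnM ltn_exp2l //; lia.
have [P1 [P10 dP1 E1]] := equipartition_step PsS (etrans (congr1 (fun j => 2 ^ j < _)%N (esym (addn0 _))) (lt 0%N isT)).
rewrite -addn1 in E1.
have [P2 [P20 dP2 E2]] := equipartition_step E1 (lt 1%N isT).
rewrite -addnS in E2.
have [P3 [P30 dP3 E3]] := equipartition_step E2 (lt 2%N isT).
exists [:: P3, P2, P1 & Ps]; split.
- by rewrite /= P10 P20 P30.
- by rewrite !big_cons expnS; move: dP1 dP2 dP3 dPs; rewrite expnS; lia.
by rewrite (_ : 3 * J.+1 = (3 * J + 2).+1)%N //; lia.
Qed.

End Partition.

(** * Polynomials restricted to lines *)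

Section Restriction.
Variable R : realType.
Local Notation point := 'rV[R]_3.
Implicit Types (p v x : point) (P Q : mpoly 3 R) (Ps : seq (mpoly 3 R)).

Definition restr P p v : {poly R} :=
  mmap polyC (fun i => (p ord0 i)%:P + v ord0 i *: 'X) P.

Lemma horner_restr P p v t : (restr P p v).[t] = pev P (p + t *: v).
Proof.
rewrite -[LHS]/(horner_eval t (restr P p v)) /restr rmorph_mmap /pev mevalE.
apply: eq_bigr => m _; rewrite /= /horner_eval hornerC; congr (_ * _).
by apply: eq_bigr => i _; rewrite /= /horner_eval !hornerE !mxE (mulrC t).
Qed.

Lemma size_restr P p v : (size (restr P p v) <= (msize P).-1.+1)%N.
Proof.
rewrite /restr /mmap; apply: leq_trans (size_sum _ _ _) _.
apply/bigmax_leqP_seq => m mP _; rewrite mul_polyC; apply: leq_trans (size_scale_leq _ _) _.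
have mdP : (mdeg m <= (msize P).-1)%N by have := msize_mdeg_lt mP; lia.
apply: leq_trans (_ : (mdeg m).+1 <= _)%N; last by rewrite ltnS.
rewrite mdegE /mmap1; apply: leq_trans (size_prod_leq _ _) _.
rewrite leq_subLR addnS ltnS -sum1_card -big_split /=.
apply: leq_sum => i _; apply: leq_trans (size_poly_exp_leq _ _) _.
rewrite add1n ltnS -[leqRHS]mul1n leq_mul2r; apply/orP; right.
have : (size ((p ord0 i)%:P + v ord0 i *: 'X)%R <= 2)%N.
  apply: leq_trans (size_polyD _ _) _; rewrite geq_max size_polyC.
  by rewrite (leq_trans (leq_b1 _)) // (leq_trans (size_scale_leq _ _)) // size_polyX.
by case: size => // k; rewrite ltnS.
Qed.

Lemma line_zeros P (l : set point) (S : seq point) : is_line l -> ~ (l `<=` zero_set P) ->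
  uniq S -> (count (fun x => (x \in l) && (pev P x == 0)%R) S <= (msize P).-1)%N.
Proof.
move=> [p [v [v0 lE]]] nlP uS.
have q0 : restr P p v != 0.
  apply/eqP => q0; apply: nlP; rewrite lE => x [t _ <-]; rewrite /zero_set /=.
  by rewrite -[LHS]/(pev P _) -horner_restr q0 horner0.
rewrite -size_filter; set S' := filter _ S.
have [f fE] : exists f : point -> R, forall x, x \in l -> x = p + f x *: v.
  have : forall x, exists t, x \in l -> x = p + t *: v.
    move=> x; case xl: (x \in l); last by exists 0.
    by move/set_mem: xl; rewrite lE => -[t _ <-]; exists t.
  by case/choice => f fE; exists f.
have S'l x : x \in S' -> x \in l /\ pev P x = 0.
  by rewrite mem_filter => /andP[/andP[xl /eqP xP] _].
rewrite -(size_map f) -ltnS; apply: leq_trans (size_restr P p v).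
apply: max_poly_roots => //.
  apply/allP => _ /mapP[x /S'l[xl xP] ->]; rewrite rootE horner_restr -fE //.
  exact/eqP.
rewrite map_inj_in_uniq ?filter_uniq // => x y /S'l[xl _] /S'l[yl _] E.
by rewrite (fE _ xl) (fE _ yl) E.
Qed.


(** The open intervals between consecutive entries are disjoint, so their roots are distinct; the
    last conclusion carries this through the induction. *)
Lemma roots_between (q : {poly R}) (e : rel R) (s : seq R) t :
  (forall a b, a < b -> e a b -> exists2 r, a < r < b & root q r) ->
  path (fun a b => (a < b) && e a b) t s ->
  exists rs, [/\ uniq rs, size rs = size s, all (root q) rs & all (fun r => t < r) rs].
Proof.
move=> qe; elim: s t => [|a s IH] t /=; first by exists [::].
move=> /andP[/andP[ta eta] /IH[rs [urs srs qrs ars]]].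
have [r /andP[tr ra] qr] := qe _ _ ta eta.
exists (r :: rs); split=> /=.
- rewrite urs andbT; apply/negP => /(allP ars) /(lt_trans ra); by rewrite ltxx.
- by rewrite srs.
- by rewrite qr.
by rewrite tr; apply: sub_all ars => r' ar'; apply: lt_trans ta ar'.
Qed.

(** Choose one parameter on the line per cell and sort. Between neighbours some polynomial changes
    sign, so the restricted product has a root there, and its degree bounds the number of roots. *)
Lemma line_crossings Ps (l : set point) (bs : seq bitseq) : is_line l -> uniq bs ->
  (forall b, b \in bs -> exists2 x, x \in l & cell Ps b x) ->
  (size bs <= (\sum_(P <- Ps) (msize P).-1).+1)%N.
Proof.
move=> [p [v [v0 ->]]] ubs bsP.
pose q := \prod_(P <- Ps) restr P p v.
have [f fE] : exists f : bitseq -> R, forall b, b \in bs -> cell Ps b (p + f b *: v).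
  have : forall b, exists t, b \in bs -> cell Ps b (p + t *: v).
    move=> b; case bb: (b \in bs); last by exists 0.
    by have [x] := bsP _ bb; rewrite inE => -[t _ <-] xb; exists t.
  by case/choice => f fE; exists f.
case: bs => [//|b0 bs] in ubs bsP fE *; set bs' := b0 :: bs in ubs bsP fE *.
have f_inj : {in bs' &, injective f}.
  move=> b b' /fE /andP[_ /eqP sb] /fE /andP[_ /eqP sb'] E.
  by rewrite -sb -sb' E.
have q0 : q != 0.
  have /andP[/allP h _] := fE b0 (mem_head _ _).
  rewrite prodf_seq_neq0; apply/allP => P /h; rewrite -horner_restr /=.
  by apply: contraNneq => ->; rewrite horner0.
have sq : (size q <= (\sum_(P <- Ps) (msize P).-1).+1)%N.
  rewrite /q; elim: (Ps) => [|P Ps' IH]; first by rewrite !big_nil size_poly1.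
  rewrite !big_cons; apply: leq_trans (size_polyMleq _ _) _.
  by move: IH (size_restr P p v); lia.
pose sg t := map (fun P => 0 < (restr P p v).[t]) Ps.
pose nz t := all (fun P => (restr P p v).[t] != 0) Ps.
pose e a b := [&& nz a, nz b & sg a != sg b].
have key a b : a < b -> e a b -> exists2 r, a < r < b & root q r.
  move=> ab /and3P[/allP na /allP nb sab].
  have [P PPs sP] : exists2 P, P \in Ps & (0 < (restr P p v).[a]) != (0 < (restr P p v).[b]).
    apply/hasP; apply: contraR sab; rewrite -all_predC => /allP h.
    by apply/eqP/eq_in_map => P /h /= /negPn /eqP.
  have neg : (restr P p v).[a] * (restr P p v).[b] < 0.
    move: sP (na _ PPs) (nb _ PPs).
    by case: (ltrgt0P (restr P p v).[a]) => //= ha; case: (ltrgt0P (restr P p v).[b]) => //= hb _ _ _;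
      rewrite ?(pmulr_rlt0 _ ha) ?(nmulr_rlt0 _ ha).
  have [r rab qr] := poly_ivtoo (ltW ab) neg.
  exists r; first by move: rab; rewrite in_itv.
  by rewrite /root /q horner_prod prodf_seq_eq0; apply/hasP; exists P.
have eP b b' : b \in bs' -> b' \in bs' -> f b < f b' -> e (f b) (f b').
  move=> bb bb' fbb'; have := (fE _ bb, fE _ bb'); rewrite /cell => -[].
  move=> /andP[na /eqP sa] /andP[nb /eqP sb]; apply/and3P; split.
  - by apply/allP => P PPs; rewrite horner_restr; apply: (allP na).
  - by apply/allP => P PPs; rewrite horner_restr; apply: (allP nb).
  rewrite /sg; under eq_map do rewrite horner_restr.
  under [X in _ != X]eq_map do rewrite horner_restr.
  by rewrite sa sb; apply: contraTneq fbb' => ->; rewrite ltxx.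
pose ts := sort <=%R (map f bs').
have uts : uniq ts by rewrite sort_uniq map_inj_in_uniq.
have tsb t : t \in ts -> exists2 b, b \in bs' & t = f b.
  by rewrite mem_sort => /mapP[b bb ->]; exists b.
have sts : sorted (fun a b => (a < b) && e a b) ts.
  have : sorted <%R ts by rewrite lt_sorted_uniq_le uts sort_le_sorted.
  apply: (sub_in_sorted (P := mem ts)); last exact/allP.
  move=> a b /tsb[c cb ->] /tsb[c' c'b ->] cc'; rewrite cc' /=.
  exact: eP.
rewrite -(size_map f) -(size_sort <=%R) -/ts.
case: ts sts {uts tsb} => [//|t ts] /= /(roots_between key)[rs [urs srs qrs _]].
by rewrite -srs; apply: leq_trans sq; apply: max_poly_roots.
Qed.

End Restriction.

(** * Incidences *)

Section Incidences.
Variable R : realType.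
Local Notation point := 'rV[R]_3.
Implicit Types (x y : point) (l : set point) (Ls : seq (set point)) (S : seq point)
  (Q : mpoly 3 R).

Definition mult Ls x := count (fun l => x \in l) Ls.

Definition inside Ls Q := [seq l <- Ls | `[< l `<=` zero_set Q >]].

Lemma line_through l x y : is_line l -> x \in l -> y \in l -> x != y ->
  l = [set x + t *: (y - x) | t in [set: R]].
Proof.
move=> [p [v [v0 ->]]] /set_mem[a _ <-] /set_mem[b _ <-] xy.
have ab : b - a != 0 by apply: contraNneq xy => /eqP; rewrite subr_eq0 => /eqP ->.
have E c : p + a *: v + c *: (p + b *: v - (p + a *: v)) = p + (a + c * (b - a)) *: v.
  by apply/rowP => i; rewrite !mxE; ring.
apply/seteqP; split=> [z [t _ <-]|z [t _ <-]].
  exists ((t - a) / (b - a)) => //; rewrite E divfK //.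
  by rewrite [a + _]addrC subrK.
by rewrite E; exists (a + t * (b - a)).
Qed.

Lemma lines_meet l l' x y : is_line l -> is_line l' -> x \in l -> y \in l ->
  x \in l' -> y \in l' -> x != y -> l = l'.
Proof.
move=> ll ll' xl yl xl' yl' xy.
by rewrite (line_through ll xl yl xy) (line_through ll' xl' yl' xy).
Qed.

(** Double counting of ordered pairs of distinct lines, which meet in at most one point. *)
Lemma pair_count Ls S r : uniq Ls -> uniq S -> {in Ls, forall l, is_line l} ->
  (forall x, x \in S -> r < mult Ls x)%N -> (size S * (r.+1 * r) <= size Ls ^ 2)%N.
Proof.
move=> uL uS Ll Sr.
have pairs x : (mult Ls x * (mult Ls x).-1 =
    \sum_(l <- Ls) \sum_(l' <- Ls) [&& l != l', x \in l & x \in l'])%N.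
  rewrite /mult -{1}sum1_count big_distrl big_mkcond /= !big_seq; apply: eq_bigr => l lL.
  case xl: (x \in l); last by rewrite big1 // => l' _; rewrite andbF.
  rewrite mul1n -sum1_count (big_rem l) //= xl add1n /=.
  rewrite [RHS](big_rem l) //= eqxx add0n big_mkcond big_seq [RHS]big_seq.
  apply: eq_bigr => l'; rewrite mem_rem_uniq // inE => /andP[l'l _].
  by rewrite eq_sym l'l /=; case: (_ \in _).
have lb : (size S * (r.+1 * r) <= \sum_(x <- S) mult Ls x * (mult Ls x).-1)%N.
  rewrite mulnC -[size S]count_predT -sum1_count big_distrr /= !big_seq muln1.
  by apply: leq_sum => x /Sr rx; rewrite leq_mul //; move: rx; case: mult.
apply: leq_trans lb _; under eq_bigr do rewrite pairs.
rewrite exchange_big /=; under eq_bigr do rewrite exchange_big.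
rewrite -[size Ls]count_predT -sum1_count expnS expn1 big_distrl /= !big_seq.
apply: leq_sum => l lL; rewrite mul1n !big_seq; apply: leq_sum => l' l'L.
have [->|ll'] := eqVneq l l'; first by rewrite big1.
have -> : (\sum_(x <- S) [&& true, x \in l & x \in l'] =
    count (fun x => (x \in l) && (x \in l')) S)%N.
  by rewrite -sum1_count [RHS]big_mkcond; apply: eq_bigr => x _ /=; case: (_ && _).
rewrite -size_filter leqNgt; apply/negP.
have := filter_uniq (fun x => (x \in l) && (x \in l')) uS.
have := mem_filter (fun x => (x \in l) && (x \in l'))^~ S.
case E : (filter _ S) => [|x [|y s]] //= mf /andP[+ _] _; rewrite inE negb_or => /andP[xy _].
have := mf x; have := mf y; rewrite !inE !eqxx ?orbT /= => /esym/andP[/andP[yl yl'] _] /esym/andP[/andP[xl xl'] _].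
by case/eqP: ll'; apply: (lines_meet (Ll _ lL) (Ll _ l'L) xl yl xl' yl' xy).
Qed.

Lemma rich_count Ls S r : uniq Ls -> uniq S -> {in Ls, forall l, is_line l} -> (2 <= r)%N ->
  (forall x, x \in S -> r./2 < mult Ls x)%N -> (size S * r ^ 2 <= 8 * size Ls ^ 2)%N.
Proof.
move=> uL uS Ll r2 Sr; have := pair_count uL uS Ll Sr.
have : (r ^ 2 <= 8 * (r./2.+1 * r./2))%N.
  have := odd_double_half r; rewrite -[in X in (X <= _)%N](odd_double_half r) => rE.
  have : (1 <= r./2)%N by rewrite half_gt0.
  by rewrite -muln2 -mulnn; case: odd {rE}; nia.
by nia.
Qed.

(** Second moments: with [d u] the number of sets containing [u], Cauchy-Schwarz gives
    [T^2 <= L (T + N^2 B)], and the hypothesis on [m] makes [L N^2 B] at most a quarter of [T^2]. *)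
Lemma family_bound (U I : eqType) (us : seq U) (s : seq I) (F : I -> pred U) (m B : R) :
  0 < m -> 0 <= B -> 4 * B * (size us)%:R <= m ^+ 2 -> uniq s ->
  (forall i, i \in s -> m <= (count (F i) us)%:R) ->
  (forall i j, i \in s -> j \in s -> i != j -> (count (predI (F i) (F j)) us)%:R <= B) ->
  (size s)%:R * m <= 2 * (size us)%:R.
Proof.
move=> m0 B0 BL us_ Fm FB.
pose L : R := (size us)%:R; pose N : R := (size s)%:R; rewrite -/L -/N in BL *.
pose d u : R := \sum_(i <- s) (F i u)%:R.
pose T := \sum_(u <- us) d u.
have cE (p : pred U) : (count p us)%:R = \sum_(u <- us) (p u)%:R :> R.
  by rewrite -sum1_count big_mkcond natr_sum; apply: eq_bigr => u _; case: (p u).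
have TE : T = \sum_(i <- s) (count (F i) us)%:R.
  by rewrite /T exchange_big; apply: eq_bigr => i _; rewrite cE.
have NE (x : R) : N * x = \sum_(i <- s) x.
  by rewrite big_const_seq count_predT iter_addr addr0 mulr_natl.
have NmT : N * m <= T by rewrite NE TE !big_seq ler_sum.
have d2 : \sum_(u <- us) d u ^+ 2 <= T + N * (N * B).
  have -> : \sum_(u <- us) d u ^+ 2 = \sum_(i <- s) \sum_(j <- s) (count (predI (F i) (F j)) us)%:R.
    under [RHS]eq_bigr do under eq_bigr do rewrite cE.
    under [RHS]eq_bigr do rewrite exchange_big.
    rewrite [RHS]exchange_big; apply: eq_bigr => u _ /=.
    rewrite expr2 {1}/d mulr_suml; apply: eq_bigr => i _; rewrite mulr_sumr.
    by apply: eq_bigr => j _; rewrite -natrM mulnb.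
  rewrite TE NE -big_split /= !big_seq; apply: ler_sum => i si /=.
  rewrite (bigD1_seq i) //= lerD //.
    by rewrite ler_nat; apply: sub_count => u /andP[].
  rewrite NE [leRHS](bigID (fun j => j != i)) /= -[leLHS]addr0.
  apply: lerD; last exact: sumr_ge0.
  rewrite !(big_seq_cond (fun j => j != i)); apply: ler_sum => j /andP[sj ji].
  by apply: FB => //; rewrite eq_sym.
(* Cauchy-Schwarz as a nonnegative sum of squares, scaled by [L] to avoid division. *)
have CS : L * T ^+ 2 <= L ^+ 2 * (T + N * (N * B)).
  have : 0 <= \sum_(u <- us) (L * d u - T) ^+ 2 by apply: sumr_ge0 => u _; apply: sqr_ge0.
  have sq u : (L * d u - T) ^+ 2 = L ^+ 2 * d u ^+ 2 + (- (2 * L * T)) * d u + T ^+ 2 by ring.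
  rewrite (eq_bigr _ (fun u _ => sq u)) !big_split /= -!mulr_sumr -/T.
  rewrite big_const_seq count_predT iter_addr addr0 -[_ *+ size us]mulr_natl -/L.
  have := ler_wpM2l (sqr_ge0 L) d2; lra.
have N0 : 0 <= N by apply: ler0n.
have T0 : 0 <= T by apply: le_trans NmT; rewrite mulr_ge0 // ltW.
have [L0|L0] := eqVneq L 0.
  have us0 : us = [::] by apply/size0nil/eqP; rewrite -(eqr_nat R) -/L L0.
  by apply: le_trans NmT _; rewrite L0 mulr0 /T us0 big_nil.
have Lp : 0 < L by rewrite lt_neqAle eq_sym L0 ler0n.
have CS' : T ^+ 2 <= L * (T + N * (N * B)).
  by rewrite -(ler_pM2l Lp) (mulrA L L) -(expr2 L).
have NB : 4 * (L * (N * (N * B))) <= T ^+ 2.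
  have h1 : N ^+ 2 * (4 * B * L) <= N ^+ 2 * m ^+ 2 by rewrite ler_wpM2l // sqr_ge0.
  have h2 : N ^+ 2 * m ^+ 2 <= T ^+ 2.
    by rewrite -exprMn ler_pXn2r // nnegrE // mulr_ge0 // ltW.
  by apply: le_trans (le_trans h1 h2); rewrite le_eqVlt; apply/orP; left; apply/eqP; ring.
apply: le_trans NmT _.
have [->|Tn0] := eqVneq T 0; first by rewrite mulr_ge0 // ltW.
have Tp : 0 < T by rewrite lt_neqAle eq_sym Tn0.
rewrite -(ler_pM2l Tp); nra.
Qed.

(** The sets are the lines through each point; two points share at most one line, so [B = 1]. *)
Lemma very_rich_count Ls S (r : nat) : uniq Ls -> uniq S -> {in Ls, forall l, is_line l} ->
  (0 < r)%N -> (4 * size Ls <= r ^ 2)%N -> (forall x, x \in S -> r <= mult Ls x)%N ->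
  (size S)%:R * r%:R <= 2 * (size Ls)%:R :> R.
Proof.
move=> uL uS Ll r0 rL Sr.
apply: (family_bound (F := fun x : point => fun l : set point => x \in l) (B := 1)) => //.
- by rewrite ltr0n.
- by rewrite mulr1 -natrM -natrX ler_nat.
- by move=> x /Sr; rewrite ler_nat.
move=> x y xS yS xy; rewrite -[1]/(1%:R) ler_nat -size_filter leqNgt; apply/negP.
have := filter_uniq (predI (fun l => x \in l) (fun l => y \in l)) uL.
have := mem_filter (predI (fun l => x \in l) (fun l => y \in l))^~ Ls.
case E : (filter _ Ls) => [|l [|l' s]] //= mf /andP[+ _] _; rewrite inE negb_or => /andP[ll' _].
have := mf l; have := mf l'; rewrite !inE !eqxx ?orbT /= => /esym/andP[/andP[xl' yl'] l'L] /esym/andP[/andP[xl yl] lL].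
by case/eqP: ll'; apply: (lines_meet (Ll _ lL) (Ll _ l'L) xl yl xl' yl' xy).
Qed.

End Incidences.

(** * Rich points on surfaces and in cells *)

Section SurfaceBounds.
Variable R : realType.
Local Notation point := 'rV[R]_3.
Implicit Types (x : point) (l : set point) (Ls : seq (set point)) (S : seq point)
  (Q : mpoly 3 R).

Lemma cover_count (T I : eqType) (S : seq T) (s : seq I) (A : I -> pred T) :
  (forall y, y \in S -> has (fun i => A i y) s) ->
  (size S <= \sum_(i <- s) count (A i) S)%N.
Proof.
move=> cov; under eq_bigr do rewrite -sum1_count big_mkcond.
rewrite exchange_big /= -sum1_size !big_seq; apply: leq_sum => y /cov /hasP[i si Aiy].
by rewrite (big_rem i) //= Aiy.
Qed.

Lemma uniq_inside Ls Q : uniq Ls -> uniq (inside Ls Q).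
Proof. exact: filter_uniq. Qed.

Lemma rich_count_lt Ls S r (M : R) : uniq Ls -> uniq S -> {in Ls, forall l, is_line l} ->
  (2 <= r)%N -> (size Ls)%:R <= M -> (forall x, x \in S -> r./2 < mult Ls x)%N ->
  (size S)%:R * r%:R ^+ 2 <= 8 * M ^+ 2.
Proof.
move=> uL uS Ll r2 LM Sr.
apply: (@le_trans _ _ (8 * (size Ls)%:R ^+ 2)).
  by rewrite -!natrX -!natrM ler_nat rich_count.
by rewrite ler_pM2l // ler_pXn2r ?nnegrE // (le_trans _ LM).
Qed.

(** Points with more than [r / 2] lines inside some listed surface through them are counted surface
    by surface. Any other point has at least [r / 2] lines transversal to a surface through it, and
    such a line meets that surface at most as often as its degree. *)
Lemma zero_part_bound Ls S (Qs : seq (mpoly 3 R)) r (M : R) :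
  uniq Ls -> uniq S -> {in Ls, forall l, is_line l} -> (2 <= r)%N ->
  (forall x, x \in S -> r <= mult Ls x)%N ->
  (forall x, x \in S -> has (fun Q => pev Q x == 0) Qs) ->
  (forall x Q, x \in S -> Q \in Qs -> (r./2 < mult (inside Ls Q) x)%N ->
     (size (inside Ls Q))%:R <= M) ->
  (size S)%:R * r%:R ^+ 2 <=
    (2 * size Ls * (\sum_(Q <- Qs) (msize Q).-1) * r)%:R + (size Qs)%:R * (8 * M ^+ 2).
Proof.
move=> uL uS Ll r2 Sr SQ QM.
pose A Q x := (pev Q x == 0) && (r./2 < mult (inside Ls Q) x)%N.
pose S1 := filter (fun x => has (fun Q => A Q x) Qs) S.
pose S2 := filter (predC (fun x => has (fun Q => A Q x) Qs)) S.
have sS : (size S = size S1 + size S2)%N by rewrite !size_filter count_predC.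
rewrite sS natrD mulrDl addrC lerD //.
  have perQ Q : (\sum_(x <- S2) (pev Q x == 0%R) *
      count (fun l => (x \in l) && ~~ `[< l `<=` zero_set Q >]) Ls <= size Ls * (msize Q).-1)%N.
    under eq_bigr do rewrite -sum1_count big_mkcond big_distrr.
    rewrite exchange_big /= -[size Ls]sum1_size big_distrl /= !big_seq.
    apply: leq_sum => l lL; rewrite mul1n.
    case: asboolP => [_|lQ]; first by rewrite big1 // => x _; rewrite andbF muln0.
    apply: leq_trans (line_zeros (Ll _ lL) lQ (filter_uniq _ uS : uniq S2)).
    rewrite -sum1_count [leqRHS]big_mkcond; apply: leq_sum => x _.
    by rewrite andbT; case: (x \in l); case: (pev Q x == 0).
  have : (size S2 * r <= 2 * size Ls * (\sum_(Q <- Qs) (msize Q).-1))%N.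
    apply: (@leq_trans (\sum_(Q <- Qs) 2 * \sum_(x <- S2) (pev Q x == 0%R) *
        count (fun l => (x \in l) && ~~ `[< l `<=` zero_set Q >]) Ls)%N); last first.
      rewrite big_distrr /=; apply: leq_sum => Q _.
      by rewrite -mulnA leq_mul2l perQ.
    rewrite -big_distrr exchange_big /= -sum1_size !big_distrl big_distrr /= !big_seq.
    apply: leq_sum => x.
    rewrite mem_filter => /andP[/= nA xS]; have /hasP[Q QQ xQ] := SQ _ xS.
    rewrite (big_rem Q) //= xQ !mul1n mulnDr; apply: leq_trans (leq_addr _ _).
    have : ~~ (r./2 < mult (inside Ls Q) x)%N.
      by apply: contra nA => rx; apply/hasP; exists Q => //; rewrite /A xQ.
    have : mult Ls x = (mult (inside Ls Q) x +
        count (fun l => (x \in l) && ~~ `[< l `<=` zero_set Q >]) Ls)%N.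
      rewrite /mult /inside count_filter; elim: (Ls) => //= l Ls' ->.
      by case: (x \in l); case: `[< l `<=` zero_set Q >] => /=; lia.
    move: (Sr _ xS); move: (mult Ls x) (mult _ x) (count _ Ls) => a b c.
    by move: (odd_double_half r); case: (odd r); lia.
  rewrite -(ler_nat R) natrM => h; rewrite expr2 mulrA natrM ler_wpM2r //.
apply: (@le_trans _ _ (\sum_(Q <- Qs) (count (A Q) S1)%:R * r%:R ^+ 2)).
  rewrite -mulr_suml ler_wpM2r ?exprn_ge0 // -natr_sum ler_nat.
  by apply: cover_count => x; rewrite mem_filter => /andP[].
have -> : (size Qs)%:R * (8 * M ^+ 2) = \sum_(Q <- Qs) 8 * M ^+ 2 :> R.
  by rewrite big_const_seq count_predT iter_addr addr0 mulr_natl.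
rewrite !big_seq; apply: ler_sum => Q QQ.
have [|/hasPn no] := boolP (has (A Q) S1); last first.
  rewrite (eq_in_count (a2 := pred0)) => [|x /no /negbTE -> //].
  by rewrite count_pred0 mul0r mulr_ge0 // sqr_ge0.
case/hasP => x; rewrite mem_filter => /andP[_ xS] /andP[_ rx].
rewrite -size_filter; apply: (@rich_count_lt (inside Ls Q)) => //.
- exact: uniq_inside.
- by rewrite filter_uniq // filter_uniq.
- by move=> l; rewrite mem_filter => /andP[_ /Ll].
- exact: QM rx.
by move=> y; rewrite mem_filter => /andP[/andP[]].
Qed.

(** The objects counted are the families of lines inside the surfaces: distinct families come from
    distinct zero sets, so they share boundedly many lines. Hence there are at most [2 L / m]
    families, each with at most [8 M^2 / r^2] points. *)
Lemma family_part_bound Ls S r D (m M : R) :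
  uniq Ls -> uniq S -> {in Ls, forall l, is_line l} -> (2 <= r)%N -> (0 < D)%N ->
  0 < m -> 4 * (3 * (D.*2 * D) ^ 2)%:R * (size Ls)%:R <= m ^+ 2 ->
  (forall x, x \in S -> exists Q, [/\ irreducible_elt Q, (msize Q <= D.+1)%N,
     (r./2 < mult (inside Ls Q) x)%N & m <= (size (inside Ls Q))%:R <= M]) ->
  (size S)%:R * r%:R ^+ 2 * m <= 16 * (size Ls)%:R * M ^+ 2.
Proof.
move=> uL uS Ll r2 D0 m0 mB SQ.
have [f fE] : exists f : point -> mpoly 3 R, forall x, x \in S ->
    [/\ irreducible_elt (f x), (msize (f x) <= D.+1)%N,
     (r./2 < mult (inside Ls (f x)) x)%N & m <= (size (inside Ls (f x)))%:R <= M].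
  have : forall x, exists Q, x \in S -> [/\ irreducible_elt Q, (msize Q <= D.+1)%N,
     (r./2 < mult (inside Ls Q) x)%N & m <= (size (inside Ls Q))%:R <= M].
    move=> x; case xS: (x \in S); last by exists 0.
    by have [Q QP] := SQ _ xS; exists Q.
  by case/choice => f fE; exists f.
pose fam := undup [seq inside Ls (f x) | x <- S].
have famP A : A \in fam -> exists2 x, x \in S & A = inside Ls (f x).
  by rewrite mem_undup => /mapP[x xS ->]; exists x.
have Nm : (size fam)%:R * m <= 2 * (size Ls)%:R.
  apply: (family_bound (F := fun A : seq (set point) => fun l => l \in A) m0 (ler0n _ _) mB).
  - exact: undup_uniq.
  - move=> A /famP[x xS ->]; have [_ _ _ /andP[mx _]] := fE _ xS.
    apply: le_trans mx _; rewrite ler_nat size_filter leq_eqVlt; apply/orP; left.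
    by apply/eqP/eq_in_count => l lL; rewrite /= mem_filter lL andbT.
  move=> A A' /famP[x xS ->] /famP[y yS ->] AA'; rewrite ler_nat -size_filter.
  have [xI xD _ _] := fE _ xS; have [yI yD _ _] := fE _ yS.
  apply: (common_lines D0 xI yI) => //.
  - by move=> E; case/eqP: AA'; rewrite /inside E.
  - exact: filter_uniq.
  move=> l; rewrite mem_filter => /andP[/andP[/=]]; rewrite !mem_filter.
  by move=> /andP[/asboolP lx lL] /andP[/asboolP ly _] _; split=> //; apply: Ll.
have M8 : (size S)%:R * r%:R ^+ 2 <= (size fam)%:R * (8 * M ^+ 2).
  apply: (@le_trans _ _ (\sum_(A <- fam) (count (fun x => r./2 < mult A x)%N S)%:R * r%:R ^+ 2)).
    rewrite -mulr_suml ler_wpM2r ?exprn_ge0 // -natr_sum ler_nat.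
    apply: cover_count => x xS; apply/hasP; exists (inside Ls (f x)).
      by rewrite mem_undup; apply/mapP; exists x.
    by have [] := fE _ xS.
  have -> : (size fam)%:R * (8 * M ^+ 2) = \sum_(A <- fam) 8 * M ^+ 2 :> R.
    by rewrite big_const_seq count_predT iter_addr addr0 mulr_natl.
  rewrite !big_seq; apply: ler_sum => A /famP[x xS ->]; have [_ _ _ /andP[_ xM]] := fE _ xS.
  rewrite -size_filter; apply: (@rich_count_lt (inside Ls (f x))) => //.
  - exact: uniq_inside.
  - exact: filter_uniq.
  - by move=> l; rewrite mem_filter => /andP[_ /Ll].
  by move=> y; rewrite mem_filter => /andP[].
apply: le_trans (ler_wpM2r (ltW m0) M8) _.
have -> : (size fam)%:R * (8 * M ^+ 2) * m = ((size fam)%:R * m) * (8 * M ^+ 2) by ring.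
have -> : 16 * (size Ls)%:R * M ^+ 2 = (2 * (size Ls)%:R) * (8 * M ^+ 2) by ring.
by rewrite ler_wpM2r // mulr_ge0 // sqr_ge0.
Qed.

Definition meeting Ls Ps b := [seq l <- Ls | `[< exists2 x : point, x \in l & cell Ps b x >]].

(** A cell is heavy if more than [38 L / w^2] lines enter it. A line enters at most
    [18 w + 1 <= 19 w] cells, so at most half of the [w^3] cells are heavy; by equipartition they
    hold at most half of the points, which is absorbed on the left. *)
Lemma cell_step Ls S Ps J (Y : R) : {in Ls, forall l, is_line l} -> (0 < size Ls)%N -> 0 <= Y ->
  (\sum_(P <- Ps) (msize P).-1 <= 18 * 2 ^ J)%N -> equipartition (3 * J) Ps S ->
  (forall b, ((2 ^ J) ^ 2 * size (meeting Ls Ps b) <= 38 * size Ls)%N ->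
     (count (cell Ps b) S)%:R <= Y) ->
  (size S)%:R <= 2 * (2 ^ J) ^+ 3 * Y +
     2 * (count (fun x => ~~ all (fun P => pev P x != 0) Ps) S)%:R.
Proof.
move=> Ll L0 Y0 degP [sPs eqP_] light; set w := (2 ^ J)%N.
pose bs : seq bitseq := [seq val b | b <- enum {: (3 * J).-tuple bool}].
have ubs : uniq bs by rewrite map_inj_uniq ?enum_uniq //; apply: val_inj.
have sbs : size bs = (w ^ 3)%N by rewrite size_map -cardT card_tuple card_bool -expnM mulnC.
set Z := count _ S.
have total : (size S <= \sum_(b <- bs) count (cell Ps b) S + Z)%N.
  (* [None] stands for the zero set. *)
  pose A b := if b is Some b' then cell Ps b' else fun x => ~~ all (fun P => pev P x != 0) Ps.
  have := @cover_count _ _ S (None :: map Some bs) A.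
  rewrite big_cons big_map addnC; apply => x xS /=; case xP: (all _ _) => //=.
  apply/hasP; exists (Some [seq 0 < pev P x | P <- Ps]); last by rewrite /A /cell xP eqxx.
  have st : size [seq 0 < pev P x | P <- Ps] == (3 * J)%N by rewrite size_map sPs.
  by apply/mapP; exists [seq 0 < pev P x | P <- Ps] => //; apply/mapP; exists (Tuple st); rewrite ?mem_enum.
pose heavy b := (38 * size Ls < w ^ 2 * size (meeting Ls Ps b))%N.
have crossings : (\sum_(b <- bs) size (meeting Ls Ps b) <= size Ls * (18 * w).+1)%N.
  pose meets (b : bitseq) l := `[< exists2 x : point, x \in l & cell Ps b x >].
  have mE b : size (meeting Ls Ps b) = (\sum_(l <- Ls) meets b l)%N.
    rewrite size_filter -sum1_count big_mkcond; apply: eq_bigr => l _.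
    by rewrite -/(meets b l); case: meets.
  rewrite (eq_bigr _ (fun b _ => mE b)) exchange_big /= -[size Ls]sum1_size big_distrl /= !big_seq.
  apply: leq_sum => l lL; rewrite mul1n.
  have -> : (\sum_(b <- bs) meets b l)%N = size (filter (meets^~ l) bs).
    rewrite size_filter -sum1_count [RHS]big_mkcond; apply: eq_bigr => b _.
    by case: (meets b l).
  apply: leq_trans (line_crossings (Ps := Ps) (Ll _ lL) (filter_uniq _ ubs) _) _ => [b|].
    by rewrite mem_filter => /andP[/asboolP].
  by rewrite ltnS.
have few_heavy : (2 * count heavy bs <= w ^ 3)%N.
  have h : (count heavy bs * (38 * size Ls) <= w ^ 2 * (size Ls * (18 * w).+1))%N.
    apply: leq_trans (_ : (\sum_(b <- bs) w ^ 2 * size (meeting Ls Ps b) <= _)%N); last first.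
      by rewrite -big_distrr leq_mul2l crossings orbT.
    rewrite -sum1_count big_distrl big_mkcond /=; apply: leq_sum => b _.
    by case: ifP => // /ltnW; rewrite mul1n.
  have w0 : (0 < w)%N by rewrite expn_gt0.
  have arith c L u : (0 < u -> c * (38 * L) <= u ^ 2 * (L * (18 * u).+1) ->
      2 * c * L <= u ^ 3 * L)%N.
    move=> u0; rewrite !expnS expn0 => hc; have : (u * u * L <= u * u * u * L)%N by nia.
    by nia.
  by rewrite -(leq_pmul2r L0); apply: arith.
have heavy_part : (2 * \sum_(b <- bs | heavy b) count (cell Ps b) S <= size S)%N.
  have W0 : (0 < w ^ 3)%N by rewrite !expn_gt0.
  rewrite -(leq_pmul2l W0); apply: (@leq_trans (2 * count heavy bs * size S)); last first.
    by rewrite leq_mul2r few_heavy orbT.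
  rewrite mulnCA -mulnA leq_mul2l /= -sum1_count big_distrl big_distrr /=.
  by apply: leq_sum => b _; rewrite mul1n (_ : w ^ 3 = 2 ^ (3 * J))%N ?eqP_ // -expnM mulnC.
have light_part : (\sum_(b <- bs | ~~ heavy b) count (cell Ps b) S)%:R <= (w%:R) ^+ 3 * Y.
  have -> : w%:R ^+ 3 * Y = \sum_(b <- bs) Y.
    by rewrite big_const_seq count_predT iter_addr addr0 sbs -natrX mulr_natl.
  rewrite natr_sum [leRHS](bigID heavy) /= -[leLHS]add0r lerD ?sumr_ge0 //.
  by apply: ler_sum => b; rewrite /heavy -leqNgt => /light.
have := total; rewrite (bigID heavy) /= => h.
have h1 : (size S)%:R <= (\sum_(b <- bs | heavy b) count (cell Ps b) S)%:R +
   (\sum_(b <- bs | ~~ heavy b) count (cell Ps b) S)%:R + Z%:R :> R by rewrite -!natrD ler_nat.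
have h2 : 2 * (\sum_(b <- bs | heavy b) count (cell Ps b) S)%:R <= (size S)%:R :> R.
  by rewrite -natrM ler_nat.
have -> : 2 ^ J = w%:R :> R by rewrite natrX.
by move: light_part; lra.
Qed.

End SurfaceBounds.

(** * The induction *)

Section Factors.
Variable R : realType.
Implicit Types (P Q : mpoly 3 R) (Ps : seq (mpoly 3 R)).

Lemma mpoly_degree_like : degree_like (fun P => (msize P).-1).
Proof.
split=> [P Q P0 Q0|P P0 /eqP].
  rewrite msizeM //; move: P0 Q0; rewrite -!msize_poly_eq0 -!lt0n.
  by move: (msize P) (msize Q) => a b; lia.
rewrite -leqn0 -subn1 leq_subLR addn0 => /msize1_polyC E; rewrite E in P0 *.
set c := mcoeff _ _ in E P0 *.
have c0 : c != 0 by apply: contraNneq P0 => ->; rewrite mpolyC0.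
by apply/unitrP; exists (mpolyC 3 c^-1); rewrite -!mpolyCM mulVf // mulfV // mpolyC1.
Qed.

(** Passing to irreducible factors makes the hypothesis on irreducible surfaces applicable, without
    raising the total degree. *)
Lemma zero_factors Ps : all (fun P => P != 0) Ps -> exists Qs : seq (mpoly 3 R),
  [/\ forall Q, Q \in Qs -> irreducible_elt Q,
      (\sum_(Q <- Qs) (msize Q).-1 <= \sum_(P <- Ps) (msize P).-1)%N &
      forall x, ~~ all (fun P => pev P x != 0) Ps -> has (fun Q => pev Q x == 0) Qs].
Proof.
elim: Ps => [_|P Ps IH /= /andP[P0 /IH[Qs [QI Qd Qz]]]].
  by exists [::]; split=> //; rewrite !big_nil.
have [u [s [uU sI E]]] := irreducible_factorization mpoly_degree_like P0.
exists (s ++ Qs); split.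
- by move=> Q; rewrite mem_cat => /orP[/sI|/QI].
- rewrite big_cat big_cons leq_add // E.
  have s0 : \prod_(p <- s) p != 0 by apply: contraNneq P0 => z; rewrite E z mulr0.
  have u0 : u != 0 by apply: contraNneq P0 => z; rewrite E z mul0r.
  rewrite mpoly_degree_like.1 // (degree_like_unit mpoly_degree_like uU) add0n.
  elim: (s) s0 => [|q t IHt]; first by rewrite !big_nil.
  rewrite !big_cons mulf_eq0 negb_or => /andP[q0 t0].
  by rewrite mpoly_degree_like.1 // leq_add2l IHt.
move=> x; rewrite negb_and negbK has_cat => /orP[/eqP Px|/Qz ->]; last by rewrite orbT.
apply/orP; left; move: Px; rewrite E /pev mevalM => /eqP; rewrite mulf_eq0 => /orP[|].
  move=> /eqP ux; have := congr1 (meval (fun i => x ord0 i)) (divrr uU).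
  by rewrite mevalM ux mul0r meval1 => /esym/eqP; rewrite oner_eq0.
elim: (s) => [|q t IHt]; first by rewrite big_nil meval1 oner_eq0.
by rewrite big_cons mevalM mulf_eq0 /= => /orP[->//|/IHt ->]; rewrite orbT.
Qed.

End Factors.

(** * Inequalities between powers *)

Section Exponents.
Variables (R : realType) (eps : R).
Hypotheses (eps0 : 0 < eps) (eps12 : eps <= 1 / 2).
Implicit Types (x n c r : R).

Let powR_add x a b : 0 < x -> x `^ (a + b) = x `^ a * x `^ b.
Proof. by move=> x0; rewrite powRD //; apply/implyP => _; rewrite gt_eqF. Qed.

Let powR_sq x a : (x `^ a) ^+ 2 = x `^ (a * 2).
Proof. by rewrite powRrM powR_mulrn // powR_ge0. Qed.

Lemma surface_size_sq x : 1 <= x -> (x `^ (1 / 2 + eps)) ^+ 2 <= x `^ (3 / 2 + eps).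
Proof. by move=> x1; rewrite powR_sq; apply: ler_powR => //; move: eps0 eps12; lra. Qed.

Lemma richness_le x r : 1 <= x -> 0 <= r -> r ^+ 2 <= 4 * x -> x * r <= 2 * x `^ (3 / 2 + eps).
Proof.
move=> x1 r0 rx; have x0 : 0 < x by apply: lt_le_trans x1.
pose h := x `^ (1 / 2).
have h0 : 0 <= h by apply: powR_ge0.
have h2 : h ^+ 2 = x.
  by rewrite powR_sq (_ : 1 / 2 * 2 = 1); [rewrite powRr1 // ltW | field].
have rh : r <= 2 * h.
  rewrite -(ler_pXn2r (n := 2)) ?nnegrE ?mulr_ge0 //.
  by rewrite exprMn h2; move: eps0 eps12; lra.
have xh : x * h <= x `^ (3 / 2 + eps).
  rewrite -{1}(powRr1 (ltW x0)) -powR_add //; apply: ler_powR => //; move: eps0 eps12; lra.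
have := ler_wpM2l (ltW x0) rh; nra.
Qed.

(** Brings the bound [16 n M^2 / m] for points lost in a cell to the target size; it reduces to
    monotonicity of the power [1 / 2 - eps], nonnegative by [eps12]. *)
Lemma surface_number_le x n : 1 <= n -> n <= x ->
  n * (x `^ (1 / 2 + eps)) ^+ 2 <= x `^ (3 / 2 + eps) * n `^ (1 / 2 + eps).
Proof.
move=> n1 nx; have n0 : 0 < n by apply: lt_le_trans n1.
have x0 : 0 < x by apply: lt_le_trans nx.
have -> : x `^ (3 / 2 + eps) = x `^ (1 / 2 - eps) * (x `^ (1 / 2 + eps)) ^+ 2.
  by rewrite powR_sq -powR_add //; congr (_ `^ _); field.
rewrite mulrAC ler_wpM2r ?sqr_ge0 //.
rewrite -[X in X <= _](powRr1 (ltW n0)).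
have -> : n `^ 1 = n `^ (1 / 2 - eps) * n `^ (1 / 2 + eps).
  by rewrite -powR_add //; congr (_ `^ _); field.
rewrite ler_wpM2r ?powR_ge0 //; apply: ge0_ler_powR; rewrite ?nnegrE ?(ltW n0) ?(ltW x0) //.
by move: eps12; lra.
Qed.

(** For large [n], crowded surfaces hold enough lines, compared with the number [B] that two may
    share, for [family_bound]. *)
Lemma many_surface_lines B (L0 : R) n : 0 < L0 -> 4 * B <= L0 `^ (2 * eps) -> L0 <= n ->
  4 * B * n <= (n `^ (1 / 2 + eps)) ^+ 2.
Proof.
move=> L00 BL Ln; have n0 : 0 < n by apply: lt_le_trans Ln.
have -> : (n `^ (1 / 2 + eps)) ^+ 2 = n `^ (2 * eps) * n `^ 1.
  by rewrite powR_sq -powR_add //; congr (_ `^ _); field.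
rewrite powRr1 ?(ltW n0) //; rewrite ler_wpM2r ?(ltW n0) //; apply: le_trans BL _.
by apply: ge0_ler_powR; rewrite ?nnegrE ?mulr_ge0 ?(ltW n0) ?(ltW L00) ?(ltW eps0).
Qed.

(** Summed over [w^3] cells with at most [38 x / w^2] lines each, the power loses the factor
    [38^(3/2 + eps)] and gains [w^(- 2 eps)]; the choice of [w] makes the product at most
    [1 / 4]. *)
Lemma cell_gain (w x n : R) : 0 < w -> 4 * 38 `^ (3 / 2 + eps) <= (w ^+ 2) `^ eps ->
  0 <= n -> 0 <= x -> w ^+ 2 * n <= 38 * x ->
  4 * w ^+ 3 * n `^ (3 / 2 + eps) <= x `^ (3 / 2 + eps).
Proof.
move=> w0 hw n0 x0 wn; set a := 3 / 2 + eps in hw *.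
have a0 : 0 <= a by rewrite /a; move: eps0 eps12; lra.
have w20 : 0 < w ^+ 2 by rewrite exprn_gt0.
have h38 : 0 < 38 `^ a :> R by apply: powR_gt0.
have h : (w ^+ 2 * n) `^ a <= (38 * x) `^ a.
  by apply: ge0_ler_powR => //; rewrite nnegrE ?mulr_ge0 // ltW.
have {}h : (w ^+ 2) `^ a * n `^ a <= 38 `^ a * x `^ a.
  by rewrite -!powRM ?(ltW w20).
have wa : (w ^+ 2) `^ a = w ^+ 3 * (w ^+ 2) `^ eps.
  rewrite /a powR_add //; congr (_ * _).
  by rewrite -(powR_mulrn 2 (ltW w0)) -powRrM -(powR_mulrn 3 (ltW w0)); congr (_ `^ _); field.
rewrite -(ler_pM2l h38); apply: le_trans h; rewrite wa.
have wn0 : 0 <= w ^+ 3 * n `^ a by rewrite mulr_ge0 ?exprn_ge0 ?powR_ge0 // ltW.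
have := ler_wpM2l wn0 hw; move: eps0 eps12; lra.
Qed.

Lemma exists_large (X b : R) : 0 < b -> 0 <= X -> exists J : nat,
  forall y, (J%:R : R) <= y -> X <= y `^ b.
Proof.
move=> b0 X0; exists (Num.Def.archi_bound (X `^ b^-1)) => y Jy.
have h : X `^ b^-1 <= y by apply: le_trans Jy; apply/ltW/archi_boundP/powR_ge0.
have -> : X = (X `^ b^-1) `^ b by rewrite -powRrM mulVf ?gt_eqF // powRr1.
apply: ge0_ler_powR; rewrite ?nnegrE ?powR_ge0 ?(ltW b0) //.
exact: le_trans (powR_ge0 _ _) h.
Qed.

End Exponents.

(** * The inductive bound *)

Section Induction.
Variable R : realType.
Local Notation point := 'rV[R]_3.
Implicit Types (x : point) (l : set point) (Ls : seq (set point)) (S : seq point)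
  (Q : mpoly 3 R).

Lemma mult_meeting Ls Ps b x : cell Ps b x -> mult (meeting Ls Ps b) x = mult Ls x.
Proof.
move=> xb; rewrite /mult /meeting count_filter; apply: eq_count => l /=.
case xl: (x \in l) => //=; apply/asboolP; by exists x.
Qed.

(** The condition is attached to points and so passes to subsets of [S]: within a cell, the points
    that violate it can be split off. *)
Definition generic_for (eps : R) D Ls S r :=
  forall x, x \in S -> (r <= mult Ls x)%N /\
    forall Q, irreducible_elt Q -> (msize Q <= D.+1)%N -> (r./2 < mult (inside Ls Q) x)%N ->
      (size (inside Ls Q))%:R < (size Ls)%:R `^ (1 / 2 + eps) :> R.

Variable eps : R.
Hypotheses (eps0 : 0 < eps) (eps12 : eps <= 1 / 2).

Let expo := 3 / 2 + eps.

(** If [r^2 > 4 n], [very_rich_count] suffices, and if [n < L0], counting pairs does. Otherwise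
    points generic for the cell fall to the induction hypothesis, and [family_part_bound] counts the
    rest. *)
Lemma cell_bound Ls S Ps b r D (L0 : nat) (K : R) :
  let n := size (meeting Ls Ps b) in
  0 <= K -> (0 < L0)%N -> (0 < D)%N ->
  4 * (3 * (D.*2 * D) ^ 2)%:R <= L0%:R `^ (2 * eps) ->
  uniq Ls -> {in Ls, forall l, is_line l} -> uniq S -> (2 <= r)%N ->
  (r ^ 2 <= 4 * size Ls)%N -> generic_for eps D Ls S r ->
  (forall S', uniq S' -> (r ^ 2 <= 4 * n)%N -> generic_for eps D (meeting Ls Ps b) S' r ->
     (size S')%:R * r%:R ^+ 2 <= K * n%:R `^ expo) ->
  (count (cell Ps b) S)%:R * r%:R ^+ 2 <=
    K * n%:R `^ expo + (20 + 8 * L0%:R ^+ 2) * (size Ls)%:R `^ expo.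
Proof.
move=> n K0 L00 D0 L0B uL Ll uS r2 rL gen IH.
set Lb := meeting Ls Ps b in n IH *; pose Sb := filter (cell Ps b) S.
rewrite -size_filter -/Sb; set P := (size Ls)%:R `^ expo.
have uLb : uniq Lb by apply: filter_uniq.
have Llb : {in Lb, forall l, is_line l} by move=> l; rewrite mem_filter => /andP[_ /Ll].
have uSb : uniq Sb by apply: filter_uniq.
have nL : (n <= size Ls)%N by rewrite /n size_filter count_size.
have L1 : (1 <= size Ls)%N.
  by case: (size Ls) rL => //; rewrite muln0 leqn0 expn_eq0 /=; case: (r) r2.
have L1R : 1 <= (size Ls)%:R :> R by rewrite ler1n.
have P1 : 1 <= P by rewrite -(powRr0 (size Ls)%:R) /P; apply: ler_powR => //; rewrite /expo; move: eps0; lra.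
have Kn : 0 <= K * n%:R `^ expo by rewrite mulr_ge0 ?powR_ge0.
have Sbr x : x \in Sb -> (r <= mult Lb x)%N.
  by rewrite mem_filter => /andP[xb xS]; rewrite mult_meeting //; have [] := gen _ xS.
have [rn|rn] := ltnP (4 * n) (r ^ 2)%N.
  have h := very_rich_count uLb uSb Llb (ltnW r2) (ltnW rn) Sbr.
  have h1 : (size Sb)%:R * r%:R ^+ 2 <= 2 * ((size Ls)%:R * r%:R) :> R.
    rewrite expr2 !mulrA ler_wpM2r //; apply: le_trans h _.
    by rewrite ler_pM2l // ler_nat.
  have h2 := richness_le eps0 eps12 L1R (ler0n _ r).
  have h3 : (size Ls)%:R * r%:R <= 2 * P.
    by apply: h2; rewrite -natrX -natrM ler_nat.
  have h4 : 0 <= 8 * L0%:R ^+ 2 * P by rewrite !mulr_ge0 ?sqr_ge0 //; lra.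
  rewrite mulrDl; lra.
have [nL0|nL0] := ltnP n L0.
  have h : (size Sb)%:R * r%:R ^+ 2 <= 8 * L0%:R ^+ 2 :> R.
    apply: (@rich_count_lt R Lb) => //; first by rewrite ler_nat ltnW.
    by move=> x /Sbr; apply: leq_trans; move: (odd_double_half r); move: r2; lia.
  have h' : 8 * L0%:R ^+ 2 <= 8 * L0%:R ^+ 2 * P by rewrite ler_peMr // mulr_ge0 ?sqr_ge0.
  rewrite mulrDl; lra.
pose M := (size Ls)%:R `^ (1 / 2 + eps); pose m := n%:R `^ (1 / 2 + eps).
have n1 : 1 <= n%:R :> R by rewrite ler1n; apply: leq_trans nL0.
have m0 : 0 < m by apply: powR_gt0; apply: lt_le_trans n1.
(* A surface crowded for the cell holds at least [m] of its lines, yet at most [M] because it is not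
   crowded for [Ls]. *)
pose bad x := `[< exists Q, [/\ irreducible_elt Q, (msize Q <= D.+1)%N,
     (r./2 < mult (inside Lb Q) x)%N & m <= (size (inside Lb Q))%:R <= M] >].
have sub x Q : (mult (inside Lb Q) x <= mult (inside Ls Q) x)%N /\
    (size (inside Lb Q) <= size (inside Ls Q))%N.
  have [p ->] : exists p, inside Lb Q = filter p (inside Ls Q).
    eexists; rewrite /inside /Lb /meeting -!filter_predI.
    by apply: eq_filter => l /=; rewrite andbC.
  by rewrite /mult (leq_count_subseq _ (filter_subseq _ _)) size_filter count_size.
have hgood : (count (predC bad) Sb)%:R * r%:R ^+ 2 <= K * n%:R `^ expo.
  rewrite -size_filter; apply: IH => //; first exact: filter_uniq.
  move=> x; rewrite mem_filter => /andP[/= nb xSb]; split; first exact: Sbr.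
  move=> Q QI QD rx; rewrite ltNge; apply: contra nb => mQ; apply/asboolP; exists Q; split=> //.
  rewrite mQ /=; move: xSb; rewrite mem_filter => /andP[_ xS].
  have [_ /(_ Q QI QD)] := gen _ xS; have [s1 s2] := sub x Q.
  move=> /(_ (leq_trans rx s1)) /ltW; apply: le_trans.
  by rewrite ler_nat.
have hbad : (count bad Sb)%:R * r%:R ^+ 2 <= 16 * P.
  rewrite -(ler_pM2r m0) -size_filter.
  apply: le_trans (@family_part_bound R Lb _ r D m M _ _ _ _ _ _ _ _) _ => //.
  - exact: filter_uniq.
  - by apply: (many_surface_lines eps0 (L0 := L0%:R)); rewrite ?ltr0n ?ler_nat.
  - by move=> x; rewrite mem_filter => /andP[/asboolP].
  rewrite -!mulrA ler_pM2l //; apply: surface_number_le => //.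
  by rewrite ler_nat.
rewrite -(count_predC bad) natrD mulrDl.
have : 0 <= 8 * L0%:R ^+ 2 * P by rewrite !mulr_ge0 ?sqr_ge0 //; lra.
rewrite mulrDl; lra.
Qed.

Let lt_scaled (a b : nat) : (0 < a -> 39 * 39 * a <= 38 * b -> a < b)%N.
Proof. lia. Qed.

Lemma generic_bound : exists (D : nat) (K : R), 0 <= K /\ forall Ls S r,
  uniq Ls -> {in Ls, forall l, is_line l} -> uniq S -> (2 <= r)%N ->
  (r ^ 2 <= 4 * size Ls)%N -> generic_for eps D Ls S r ->
  (size S)%:R * r%:R ^+ 2 <= K * (size Ls)%:R `^ expo.
Proof.
have [J1 J1P] := exists_large eps0 (mulr_ge0 (ler0n R 4) (powR_ge0 38 expo)).
(* [J1] provides the gain; the summand 39 gives [w >= 39], so a light cell meets fewer lines than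
   [Ls] has. *)
pose J := (J1 + 39)%N; pose w : R := 2 ^+ J.
have Jw : J%:R <= w by rewrite /w -natrX ler_nat ltnW // ltn_expl.
have w39n : (39 <= 2 ^ J)%N by rewrite (leq_trans (leq_addl J1 39)) // ltnW // ltn_expl.
have w39 : 39 <= w by rewrite /w -natrX ler_nat.
have w0 : 0 < w by apply: lt_le_trans w39.
have ww : w <= w ^+ 2 by rewrite expr2 ler_peMr ?(ltW w0) //; apply: le_trans w39; rewrite ler1n.
have gain : 4 * 38 `^ expo <= (w ^+ 2) `^ eps.
  by apply: J1P; apply: le_trans ww; apply: le_trans Jw; rewrite ler_nat leq_addr.
(* The degree of the partition, which bounds that of every irreducible factor. *)
pose D := (18 * 2 ^ J)%N.
have D0 : (0 < D)%N by rewrite muln_gt0 expn_gt0.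
pose B : R := (3 * (D.*2 * D) ^ 2)%:R.
have [L1 L1P] := @exists_large R (4 * B) (2 * eps) (mulr_gt0 (ltr0n R 2) eps0) (mulr_ge0 (ler0n R 4) (ler0n R _)).
pose L0 := L1.+1.
have L0B : 4 * B <= L0%:R `^ (2 * eps) by apply: L1P; rewrite ler_nat.
pose C : R := 20 + 8 * L0%:R ^+ 2.
have C0 : 0 <= C by rewrite addr_ge0 // mulr_ge0 // sqr_ge0.
(* Half of [K] pays for the inductive terms, reduced by [cell_gain]; the other half for the constant
   of the cells and for the zero set. *)
pose K : R := 4 * w ^+ 3 * C + 48 * D%:R.
have K0 : 0 <= K by rewrite addr_ge0 // ?mulr_ge0 // exprn_ge0 // ltW.
exists D, K; split=> // Ls.
have [N] := ubnP (size Ls); elim: N Ls => // N IH Ls LN S r uL Ll uS r2 rL gen.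
have L1' : (0 < size Ls)%N.
  by case: (size Ls) rL => //; rewrite muln0 leqn0 expn_eq0 /=; case: (r) r2.
have L1R : 1 <= (size Ls)%:R :> R by rewrite ler1n.
set P := (size Ls)%:R `^ expo.
have P0 : 0 <= P by apply: powR_ge0.
have r0 : 0 < r%:R ^+ 2 :> R by rewrite exprn_gt0 // ltr0n ltnW.
have [Ps [Ps0 dPs PsS]] := equipartition_exists J S.
have [Qs [QI Qd Qz]] := zero_factors Ps0.
have QsD : (\sum_(Q <- Qs) (msize Q).-1 <= D)%N := leq_trans Qd dPs.
pose Y : R := (K * (P / (4 * w ^+ 3)) + C * P) / r%:R ^+ 2.
have w3 : 0 < w ^+ 3 by rewrite exprn_gt0.
have Y0 : 0 <= Y.
  rewrite divr_ge0 ?(ltW r0) // addr_ge0 // mulr_ge0 // divr_ge0 // mulr_ge0 // ltW //.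
have step := cell_step Ll L1' Y0 dPs PsS.
pose off x := ~~ all (fun P => pev P x != 0) Ps.
have {}step : (size S)%:R <= 2 * w ^+ 3 * Y + 2 * (count off S)%:R.
  apply: step => b light; rewrite /Y ler_pdivlMr //.
  apply: le_trans (cell_bound K0 (ltn0Sn L1) D0 L0B uL Ll uS r2 rL gen _) _.
    move=> S' uS' rn gen'; apply: IH => //.
    - move: light LN rn; set n := size _ => light LN rn.
      have n39 : (39 * 39 * n <= 38 * size Ls)%N.
        by apply: leq_trans light; rewrite -mulnn !leq_mul.
      have n0 : (0 < n)%N by case: (n) rn => //; rewrite muln0 leqn0 expn_eq0 /=; case: (r) r2.
      by rewrite -ltnS; apply: leq_trans LN; rewrite ltnS lt_scaled.
    - exact: filter_uniq.
    - by move=> l; rewrite mem_filter => /andP[_ /Ll].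
  rewrite lerD2r ler_wpM2l // ler_pdivlMr ?mulr_gt0 // mulrC.
  apply: cell_gain => //; rewrite ?ler0n //.
  by rewrite /w -!natrX -!natrM ler_nat.
(* Transversal lines contribute [4 D P], and each of the at most [D] components [8 P]. *)
have zero : (count off S)%:R * r%:R ^+ 2 <= 12 * D%:R * P.
  have sQs : (size Qs <= D)%N.
    apply: leq_trans QsD; rewrite -sum1_size !big_seq; apply: leq_sum => Q /QI[Q0 QU _].
    by rewrite lt0n; apply: contra QU => /eqP; apply: (@mpoly_degree_like R).2.
  pose M := (size Ls)%:R `^ (1 / 2 + eps).
  rewrite -size_filter; apply: le_trans (@zero_part_bound R Ls _ Qs r M _ _ _ _ _ _ _) _ => //.
  - exact: filter_uniq.
  - by move=> x; rewrite mem_filter => /andP[_ /gen[]].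
  - by move=> x; rewrite mem_filter => /andP[/Qz].
  - move=> x Q; rewrite mem_filter => /andP[_ /gen[_ g]] QQ rx; apply/ltW/g => //.
      exact: QI.
    have QD : ((msize Q).-1 <= D)%N by apply: leq_trans QsD; rewrite (big_rem Q) //= leq_addr.
    by rewrite -ltnS in QD; apply: leq_trans QD; rewrite leqSpred.
  have h1 : (2 * size Ls * (\sum_(Q <- Qs) (msize Q).-1) * r)%:R <= 2 * D%:R * ((size Ls)%:R * r%:R) :> R.
    rewrite -!natrM ler_nat mulnA (mulnAC 2 D (size Ls)).
    by rewrite leq_mul2r leq_mul2l QsD !orbT.
  have h2 : (size Ls)%:R * r%:R <= 2 * P.
    by apply: richness_le => //; rewrite ?ler0n // -natrX -natrM ler_nat.
  have h3 : (size Qs)%:R * (8 * M ^+ 2) <= D%:R * (8 * P).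
    by rewrite ler_pM ?ler_nat ?ler_pM2l ?surface_size_sq // mulr_ge0 ?sqr_ge0.
  have h4 : 2 * D%:R * ((size Ls)%:R * r%:R) <= 2 * D%:R * (2 * P) by rewrite ler_wpM2l // mulr_ge0.
  by apply: le_trans (lerD (le_trans h1 h4) h3) _; rewrite le_eqVlt; apply/orP; left; apply/eqP; ring.
rewrite -(ler_pM2r r0) in step; apply: le_trans step _.
rewrite mulrDl.
have -> : 2 * w ^+ 3 * Y * r%:R ^+ 2 = K / 2 * P + 2 * w ^+ 3 * C * P.
  rewrite /Y; field.
  by rewrite pnatr_eq0 -lt0n (ltnW r2) gt_eqF.
rewrite -[X in _ + X <= _]mulrA.
apply: (@le_trans _ _ (K / 2 * P + 2 * w ^+ 3 * C * P + 2 * (12 * D%:R * P))).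
  by rewrite lerD2l ler_pM2l.
by rewrite le_eqVlt; apply/orP; left; apply/eqP; rewrite /K; field.
Qed.

End Induction.

(** * From lists of points to the set of rich points *)

Section FiniteSets.
Variable R : realType.
Implicit Types (Ls : {fset set 'rV[R]_3}) (S : seq 'rV[R]_3).

Lemma card_fset_filter (T : choiceType) (A : {fset T}) (p : pred T) :
  #|` [fset x in A | p x]%fset| = count p (enum_fset A).
Proof.
rewrite -size_filter; apply/perm_size/uniq_perm; rewrite ?fset_uniq ?filter_uniq //.
by move=> x; rewrite mem_filter !inE /= andbC.
Qed.

(** Finiteness comes first: an infinite set of rich points would contain a finite one larger than
    [rich_count] allows. *)
Lemma rich_bound Ls r (bound : R) : {in Ls, forall l, is_line l} -> (2 <= r)%N ->
  (forall S, uniq S -> (forall x, x \in S -> r <= mult (enum_fset Ls) x)%N ->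
     (size S)%:R * r%:R ^+ 2 <= bound) ->
  finite_set (rich_points Ls r) /\
  (#|` fset_set (rich_points Ls r)|%fset)%:R <= bound * r%:R ^- 2.
Proof.
move=> Ll r2 Sb; have r0 : 0 < r%:R ^+ 2 :> R by rewrite exprn_gt0 // ltr0n ltnW.
have rich x : rich_points Ls r x -> (r <= mult (enum_fset Ls) x)%N.
  by rewrite /rich_points /= card_fset_filter.
have fin : finite_set (rich_points Ls r).
  apply: contrapT => inf.
  have [A Ar sA] := infinite_set_fset (8 * size (enum_fset Ls) ^ 2).+1 inf.
  have : (size (enum_fset A) * r ^ 2 <= 8 * size (enum_fset Ls) ^ 2)%N.
    apply: (rich_count (fset_uniq Ls) (fset_uniq A) Ll r2).
    move=> x /Ar /rich; apply: leq_trans.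
    by rewrite -[X in (_ < X)%N]odd_double_half; move: r2; case: (odd r); lia.
  rewrite leqNgt => /negP; apply; apply: leq_trans sA _.
  by rewrite leq_pmulr // expn_gt0; case: (r) r2.
split=> //; rewrite ler_pdivlMr //; apply: Sb; first exact: fset_uniq.
by move=> x; rewrite in_fset_set // => /set_mem /rich.
Qed.

End FiniteSets.

Unset Implicit Arguments.

Theorem theorem0p2 (R : realType) (eps : R) (heps : 0 < eps) :
  exists (D : nat) (K : R),
    forall (Ls : {fset set 'rV[R]_3}) (r : nat),
      (forall l : set 'rV[R]_3, l \in Ls -> is_line l) ->
      (forall S : set 'rV[R]_3, irreducible_surface D S ->
        (#|` lines_in Ls S|%fset)%:R < (#|` Ls|%fset)%:R `^ (1 / 2 + eps)) ->
      (2 <= r)%N ->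
      r%:R <= 2 * (#|` Ls|%fset)%:R `^ (1 / 2) :> R ->
      finite_set (rich_points Ls r) /\
      (#|` fset_set (rich_points Ls r)|%fset)%:R
        <= K * (#|` Ls|%fset)%:R `^ (3 / 2 + eps) * r%:R ^- 2.
Proof.
have half_lt S (Ls : {fset set 'rV[R]_3}) r : (2 <= r)%N ->
    (forall x, x \in S -> r <= mult (enum_fset Ls) x)%N ->
    (forall x, x \in S -> r./2 < mult (enum_fset Ls) x)%N.
  move=> r2 Sr x /Sr; apply: leq_trans.
  by rewrite -[X in (_ < X)%N]odd_double_half; move: r2; case: (odd r); lia.
have sq_le (L : nat) (r : nat) : r%:R <= 2 * L%:R `^ (1 / 2) :> R -> (r ^ 2 <= 4 * L)%N.
  move=> h; rewrite -(ler_nat R) natrX natrM.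
  have -> : 4 * L%:R = (2 * L%:R `^ (1 / 2)) ^+ 2 :> R.
    rewrite exprMn mul1r powR12_sqrt // sqr_sqrtr //; ring.
  by rewrite ler_pXn2r ?nnegrE // mulr_ge0 ?powR_ge0.
have [eps12|eps12] := leP eps (1 / 2).
  have [D [K [K0 bound]]] := generic_bound heps eps12.
  exists D, K => Ls r Ll surf r2 rL; apply: rich_bound => // S uS Sr.
  apply: bound => //; [exact: fset_uniq | exact: sq_le |].
  move=> x xS; split; first exact: Sr.
  (* No surface of degree at most [D] is crowded, so every rich point is generic. *)
  move=> Q QI QD _; have := surf (zero_set Q); rewrite /lines_in card_fset_filter.
  by rewrite /inside size_filter; apply; exists Q.
(* For [eps > 1 / 2] the exponent exceeds 2, and counting pairs of lines suffices. *)
exists 0%N, 8 => Ls r Ll _ r2 rL; apply: rich_bound => // S uS Sr.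
apply: le_trans (@rich_count_lt R (enum_fset Ls) S r _ _ uS Ll r2 (lexx _) _) _ => //.
- exact: fset_uniq.
- exact: half_lt.
have L1 : (1 <= size (enum_fset Ls))%N.
  have := sq_le _ _ rL; case: (size _) => //; rewrite muln0 leqn0 expn_eq0 /=.
  by case: (r) r2.
rewrite ler_pM2l // -powR_mulrn //; apply: ler_powR; first by rewrite ler1n.
by move: eps12; lra.
Qed.
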